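(* Let $H$ be a Hopf algebra over a field $\Bbbk$. There is a bijective correspondence between (isomorphism classes of) left $H$-covariant first order vector field calculi $(\mathfrak{X},\mathscr{L})$ on $H$ with $\dim{}^{\mathrm{co}H}\mathfrak{X}<\infty$ and quantum tangent spaces $\mathfrak{g}\subseteq H^\circ$; under it a quantum tangent space $\mathfrak{g}$ corresponds to the calculus $(H\otimes\mathfrak{g},\mathscr{L})$ with $\mathscr{L}_{h\otimes\chi}(g)=hg_1\chi(g_2)$.
   Context: $H^\circ$ is the finite (Sweedler) dual Hopf algebra of $H$, with $\Delta(u)(h\otimes g)=u(hg)$ and unit $\varepsilon$; $(H^\circ)^+=\{u\in H^\circ\mid u(1)=0\}$. A subspace $\mathfrak{g}\subset(H^\circ)^+$ is a quantum tangent space if it is finite-dimensional and $\Delta(\mathfrak{g})\subset\mathfrak{g}\otimes\varepsilon+H^\circ\otimes\mathfrak{g}$. For a basis $\{\chi_i\}$ of such $\mathfrak{g}$ there are $f_i^j\in H^\circ$ with $\Delta(\chi_i)=\chi_i\otimes\varepsilon+\sum_jf_i^j\otimes\chi_j$; the space $H\otimes\mathfrak{g}$ is an $H$-bimodule via $h'\cdot(h\otimes\chi_i)\cdot g=\sum_jh'hg_1f_i^j(g_2)\otimes\chi_j$ with left $H$-coaction $h\otimes\chi\mapsto h_1\otimes h_2\otimes\chi$. A first order vector field calculus (FOVC) on $H$ is a pair $(\mathfrak{X},\mathscr{L})$ where $\mathfrak{X}$ is an $H$-bimodule and $\mathscr{L}\colon\mathfrak{X}\to\mathrm{End}_\Bbbk(H)$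 is $\Bbbk$-linear, injective, left $H$-linear ($\mathscr{L}_{h\cdot X}(g)=h\mathscr{L}_X(g)$) and satisfies $\mathscr{L}_X(hg)=\mathscr{L}_X(h)g+\mathscr{L}_{X\cdot h}(g)$. It is left $H$-covariant if $\mathfrak{X}$ carries a left $H$-coaction ${}_{\mathfrak{X}}\Delta$ with ${}_{\mathfrak{X}}\Delta(h\cdot X\cdot h')=\Delta(h)\,{}_{\mathfrak{X}}\Delta(X)\,\Delta(h')$ and $\mathfrak{X}\otimes H\to H$, $X\otimes h\mapsto\mathscr{L}_X(h)$, is left $H$-colinear (diagonal coaction on the source, $\Delta$ on the target). ${}^{\mathrm{co}H}\mathfrak{X}=\{X\in\mathfrak{X}\mid{}_{\mathfrak{X}}\Delta(X)=1\otimes X\}$. Isomorphisms are left $H$-colinear $H$-bimodule isomorphisms $\Phi$ with $\mathscr{L}'\circ\Phi=\mathscr{L}$. *)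

(* Defs.v *)
From HB Require Import structures.
From mathcomp Require Import all_boot all_algebra.
From mathcomp Require Import boolp classical_sets functions.

Set Implicit Arguments.
Unset Strict Implicit.
Unset Printing Implicit Defensive.

Import GRing.Theory.
Local Open Scope ring_scope.
Local Open Scope quotient_scope.

Definition bilin (k : fieldType) (V W U : lmodType k) (b : V -> W -> U) : Prop :=
  (forall w, linear (b^~ w)) /\ (forall v, linear (b v)).

Section Tensor.
Variables (k : fieldType) (V W : lmodType k).

Definition tsum (U : lmodType k) (b : V -> W -> U) (s : seq (V * W)) : U :=
  \sum_(p <- s) b p.1 p.2.

(* The formal sum of the pairs in a list represents a tensor; two formal sums
   are the same tensor iff no bilinear map distinguishes them. *)
Definition tensor_eq (s t : seq (V * W)) : bool :=
  `[< forall (U : lmodType k) (b : V -> W -> U), bilin b -> tsum b s = tsum b t >].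

Lemma tensor_eq_refl : reflexive tensor_eq.
Proof. by move=> s; apply/asboolP. Qed.

Lemma tensor_eq_sym : symmetric tensor_eq.
Proof. by move=> s t; apply/asboolP/asboolP => H U b /H. Qed.

Lemma tensor_eq_trans : transitive tensor_eq.
Proof.
move=> t s r /asboolP H1 /asboolP H2; apply/asboolP => U b hb.
by rewrite H1 // H2.
Qed.

Canonical tensor_equiv :=
  EquivRel tensor_eq tensor_eq_refl tensor_eq_sym tensor_eq_trans.

Definition tensor : Type := {eq_quot tensor_equiv}.

HB.instance Definition _ := Choice.on tensor.
HB.instance Definition _ := Quotient.on tensor.

(* The linear map on V (x) W induced by b; it depends on the chosen
   representative of t unless b is bilinear. *)
Definition tlift (U : lmodType k) (b : V -> W -> U) (t : tensor) : U :=
  tsum b (repr t).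

Definition tpure (v : V) (w : W) : tensor := \pi_tensor [:: (v, w)].

Lemma tlift_pi (U : lmodType k) (b : V -> W -> U) s :
  bilin b -> tlift b (\pi_tensor s) = tsum b s.
Proof.
move=> hb; rewrite /tlift; case: piP => t /eqmodP /asboolP H.
by rewrite -H.
Qed.

Lemma tensorP (s t : tensor) :
  (forall (U : lmodType k) (b : V -> W -> U), bilin b -> tlift b s = tlift b t) ->
  s = t.
Proof.
move=> H; rewrite -[s]reprK -[t]reprK; apply/eqmodP/asboolP => U b hb.
by have := H U b hb.
Qed.

Definition tzero : tensor := \pi_tensor [::].
Definition tadd (s t : tensor) : tensor := \pi_tensor (repr s ++ repr t).
Definition tscale (a : k) (t : tensor) : tensor :=
  \pi_tensor [seq (a *: p.1, p.2) | p <- repr t].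
Definition topp (t : tensor) : tensor := tscale (-1) t.

Lemma bilinZl (U : lmodType k) (b : V -> W -> U) a v w :
  bilin b -> b (a *: v) w = a *: b v w.
Proof.
case=> /(_ w) hl _; have h0 : b 0 w = 0.
  have := hl 1 0 0; rewrite !scale1r addr0 => /esym/eqP.
  by rewrite -subr_eq0 addrK => /eqP.
by have := hl a v 0; rewrite addr0 h0 addr0.
Qed.

Lemma tlift0 (U : lmodType k) (b : V -> W -> U) : bilin b -> tlift b tzero = 0.
Proof. by move=> hb; rewrite tlift_pi // /tsum big_nil. Qed.

Lemma tliftD (U : lmodType k) (b : V -> W -> U) s t :
  bilin b -> tlift b (tadd s t) = tlift b s + tlift b t.
Proof. by move=> hb; rewrite tlift_pi // /tsum big_cat. Qed.

Lemma tliftZ (U : lmodType k) (b : V -> W -> U) a t :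
  bilin b -> tlift b (tscale a t) = a *: tlift b t.
Proof.
move=> hb; rewrite tlift_pi // /tlift /tsum big_map scaler_sumr.
by apply: eq_bigr => p _ /=; rewrite bilinZl.
Qed.

Lemma taddA : associative tadd.
Proof. by move=> r s t; apply: tensorP => U b hb; rewrite !tliftD // addrA. Qed.

Lemma taddC : commutative tadd.
Proof. by move=> s t; apply: tensorP => U b hb; rewrite !tliftD // addrC. Qed.

Lemma tadd0 : left_id tzero tadd.
Proof. by move=> t; apply: tensorP => U b hb; rewrite tliftD // tlift0 // add0r. Qed.

Lemma taddN : left_inverse tzero topp tadd.
Proof.
move=> t; apply: tensorP => U b hb.
by rewrite tliftD // tliftZ // tlift0 // scaleN1r addNr.
Qed.

HB.instance Definition _ := GRing.isZmodule.Build tensor taddA taddC tadd0 taddN.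

Lemma tscaleA a c t : tscale a (tscale c t) = tscale (a * c) t.
Proof. by apply: tensorP => U b hb; rewrite !tliftZ // scalerA. Qed.

Lemma tscale1 : left_id 1 tscale.
Proof. by move=> t; apply: tensorP => U b hb; rewrite tliftZ // scale1r. Qed.

Lemma tscaleDr : right_distributive tscale +%R.
Proof.
move=> a s t; apply: tensorP => U b hb.
by rewrite [LHS]tliftZ // ![in RHS]tliftD // [in LHS]tliftD // !tliftZ // scalerDr.
Qed.

Lemma tscaleDl t : {morph tscale^~ t : a c / a + c}.
Proof.
move=> a c; apply: tensorP => U b hb.
by rewrite [RHS]tliftD // !tliftZ // scalerDl.
Qed.

HB.instance Definition _ := GRing.Zmodule_isLmodule.Build k tensor
  tscaleA tscale1 tscaleDr tscaleDl.

Lemma tlift_linear (U : lmodType k) (b : V -> W -> U) : bilin b -> linear (tlift b).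
Proof. by move=> hb a s t; rewrite [LHS]tliftD // tliftZ. Qed.

Lemma tlift_pure (U : lmodType k) (b : V -> W -> U) v w :
  bilin b -> tlift b (tpure v w) = b v w.
Proof. by move=> hb; rewrite tlift_pi // /tsum big_seq1. Qed.

Lemma tpure_bilin : bilin tpure.
Proof.
split=> [w|v] a x y; apply: tensorP => U b hb.
  by rewrite tlift_linear // !tlift_pure //; case: hb => ->.
by rewrite tlift_linear // !tlift_pure //; case: hb => _ ->.
Qed.

Lemma tensor_sum (t : tensor) : t = \sum_(p <- repr t) tpure p.1 p.2.
Proof.
apply: tensorP => U b hb; rewrite [LHS]/tlift /tsum.
elim: (repr t) => [|p s IH]; first by rewrite !big_nil tlift0.
by rewrite !big_cons [RHS]tliftD // tlift_pure // IH.
Qed.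

End Tensor.

Notation "v \ox w" := (tpure v w) (at level 40, left associativity) : ring_scope.

(* Sweedler-style notation for the value at t of the linear map v (x) w |-> E;
   it is used only for E bilinear in (v, w), see tlift_pure and tlift_linear. *)
Notation "\tsum_ ( v , w <- t ) E" := (tlift (fun v w => E) t)
  (at level 41, v name, w name, t at level 41, E at level 41,
   format "\tsum_ ( v ,  w  <-  t )  E") : ring_scope.

HB.mixin Record Algebra_isHopf (k : fieldType) H of GRing.Algebra k H := {
  comul : {linear H -> tensor H H};
  counit : {scalar H};
  antipode : {linear H -> H};
  comulA : forall h : H,
    \tsum_(a, b <- comul h) \tsum_(a1, a2 <- comul a) (a1 \ox (a2 \ox b)) =
    \tsum_(a, b <- comul h) (a \ox comul b);
  comul_counitl : forall h : H, \tsum_(a, b <- comul h) (counit a *: b) = h;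
  comul_counitr : forall h : H, \tsum_(a, b <- comul h) (counit b *: a) = h;
  comul1 : comul 1 = 1 \ox 1;
  comulM : forall h g : H, comul (h * g) =
    \tsum_(a, b <- comul h) \tsum_(c, d <- comul g) ((a * c) \ox (b * d));
  counit1 : counit 1 = 1;
  counitM : forall h g : H, counit (h * g) = counit h * counit g;
  antipodel : forall h : H, \tsum_(a, b <- comul h) (antipode a * b) = (counit h)%:A;
  antipoder : forall h : H, \tsum_(a, b <- comul h) (a * antipode b) = (counit h)%:A
}.

#[short(type="hopfAlgType")]
HB.structure Definition Hopf (k : fieldType) := {H of Algebra_isHopf k H & GRing.Algebra k H}.

Section FiniteDual.
Variables (k : fieldType) (H : hopfAlgType k).

Definition ideal (I : H -> Prop) : Prop :=
  submod_closed [pred h | `[< I h >] ] /\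
  forall a h, I h -> I (a * h) /\ I (h * a).

(* dim (H / I) is finite: H / I embeds linearly in some k^n. *)
Definition cofinite (I : H -> Prop) : Prop :=
  exists n (p : {linear H -> 'rV[k]_n}), forall h, I h <-> p h = 0.

Definition fdual_pred : {pred H -> k^o} := fun u =>
  `[< linear u /\
      exists I, [/\ ideal I, cofinite I & forall h, I h -> u h = 0] >].

Record fdual := FDual { fdual_val :> H -> k^o; fdual_valP : fdual_val \in fdual_pred }.

HB.instance Definition _ := [isSub for fdual_val].
HB.instance Definition _ := [Choice of fdual by <:].

Lemma fdual_submod : submod_closed fdual_pred.
Proof.
split.
  apply/asboolP; split; first by move=> a x y; rewrite /= scaler0 addr0.
  exists (fun=> True); split=> //.
    split=> //; split=> [|a x y _ _]; exact/asboolP.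
  exists 0, \0 => h; split=> // _; exact/matrixP => i [].
move=> a u v /asboolP[lu [I [iI [n [p pP]] uI]]] /asboolP[lv [J [iJ [m [q qP]] vJ]]].
apply/asboolP; split.
  move=> c x y; rewrite !fctE lu lv !scalerDr !scalerA [c * a]mulrC -!addrA.
  by congr (_ + _); rewrite addrCA.
exists (fun h => I h /\ J h); split.
- split; first split.
  + by apply/asboolP; split; [have [[/asboolP]] := iI|have [[/asboolP]] := iJ].
  + move=> c x y /asboolP[Ix Jx] /asboolP[Iy Jy]; apply/asboolP; split.
      by have [[_ H1] _] := iI; apply/asboolP/H1; apply/asboolP.
    by have [[_ H1] _] := iJ; apply/asboolP/H1; apply/asboolP.
  + move=> c h [Ih Jh]; have [_ /(_ c h Ih)[]] := iI.
    by have [_ /(_ c h Jh)[]] := iJ.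
- have lpq : linear (fun h => row_mx (p h) (q h)).
    by move=> c x y; rewrite !linearP scale_row_mx add_row_mx.
  pose lpqM := GRing.isLinear.Build _ _ _ _ _ lpq.
  pose pq : {linear H -> 'rV[k]_(n + m)} := HB.pack (fun h => row_mx (p h) (q h)) lpqM.
  exists (n + m)%N, pq => h; rewrite pP qP /=; split=> [[-> ->]|]; first exact: row_mx0.
  by rewrite -row_mx0 => /eq_row_mx.
- by move=> h [Ih Jh]; rewrite !fctE uI // vJ // scaler0 addr0.
Qed.

HB.instance Definition _ :=
  GRing.isSubmodClosed.Build k (H -> k^o) fdual_pred fdual_submod.
HB.instance Definition _ := [SubChoice_isSubLmodule of fdual by <:].

Lemma counit_fdual : (counit : H -> k^o) \in fdual_pred.
Proof.
apply/asboolP; split; first by move=> a x y; rewrite linearP.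
exists (fun h => counit h = 0 :> k); split=> //.
  split; first split.
  - by apply/asboolP; rewrite linear0.
  - by move=> a x y /asboolP hx /asboolP hy; apply/asboolP; rewrite linearP /= hx hy mulr0 addr0.
  - by move=> a h e; rewrite !counitM e mulr0 mul0r.
have lp : linear (fun h : H => const_mx (counit h) : 'rV[k]_1).
  by move=> c x y; apply/matrixP => i j; rewrite !mxE linearP.
pose lpM := GRing.isLinear.Build _ _ _ _ _ lp.
pose p : {linear H -> 'rV[k]_1} := HB.pack (fun h : H => const_mx (counit h) : 'rV[k]_1) lpM.
exists 1, p => h; split=> [e|/matrixP/(_ 0 0)]; last by rewrite !mxE.
by apply/matrixP => i j; rewrite !mxE e.
Qed.

Definition fdual_counit : fdual := FDual counit_fdual.

Definition fdual_eval2 (t : tensor fdual fdual) (h g : H) : k :=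
  tlift (fun u v : fdual => u h * v g : k^o) t.

Lemma fdual_linear (u : fdual) : linear u.
Proof. by have /asboolP[] := fdual_valP u. Qed.

Lemma fdual_ext (u v : fdual) : u =1 v -> u = v.
Proof. by move=> e; apply: val_inj; apply/funext. Qed.

Lemma fdualD (u v : fdual) h : (u + v) h = u h + v h.
Proof. by []. Qed.

Lemma fdualZ a (u : fdual) h : (a *: u) h = a * u h.
Proof. by []. Qed.

Lemma fdual0 h : (0 : fdual) h = 0.
Proof. by []. Qed.

Lemma fdual_sum (I : Type) (r : seq I) (F : I -> fdual) h :
  (\sum_(i <- r) F i) h = \sum_(i <- r) F i h.
Proof.
elim: r => [|i r IH]; first by rewrite !big_nil.
by rewrite !big_cons fdualD IH.
Qed.

Lemma eval2_bilin h g : bilin (fun u v : fdual => u h * v g : k^o).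
Proof.
split=> [w|v] a x y; rewrite fdualD fdualZ.
  by rewrite mulrDl -mulrA.
by rewrite mulrDr mulrCA.
Qed.

(* A linear map to k^n is determined by its values at finitely many vectors. *)
Lemma finite_test (n : nat) (p : {linear H -> 'rV[k]_n}) :
  exists m (s : 'I_m -> H) (q : 'M[k]_(n, m)),
    forall h, p h = \sum_(i < m) (p h *m q) 0 i *: p (s i).
Proof.
pose P r := `[< exists m (s : 'I_m -> H), \rank (\matrix_i p (s i)) = r >].
have exP : exists r, P r.
  by exists (\rank (\matrix_(i < 0) p 0)); apply/asboolP; exists 0, (fun=> 0).
have ubP r : P r -> (r <= n)%N.
  by move=> /asboolP[m [s <-]]; exact: rank_leq_col.
case: (ex_maxnP exP ubP) => r /asboolP[m [s rs]] maxr.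
exists m, s, (pinvmx (\matrix_i p (s i))) => h.
set M := \matrix_i p (s i) in rs *.
have sub : (p h <= M)%MS.
  pose s' (i : 'I_(1 + m)) := match fintype.split i with inl _ => h | inr j => s j end.
  have eM : \matrix_i p (s' i) = col_mx (p h) M.
    by apply/matrixP => i l; rewrite !mxE /s'; case: fintype.split => j; rewrite ?mxE ?ord1.
  have le : (\rank (col_mx (p h) M) <= r)%N.
    by apply: maxr; apply/asboolP; exists (1 + m)%N, s'; rewrite eM.
  have sM : (M <= col_mx (p h) M)%MS by rewrite -addsmxE addsmxSr.
  have : (M == col_mx (p h) M)%MS by rewrite -(geq_leqif (mxrank_leqif_eq sM)) rs.
  by case/andP => _; apply: submx_trans; rewrite -addsmxE addsmxSl.
rewrite -{1}(mulmxKpV sub) mulmx_sum_row.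
by apply: eq_bigr => i _; rewrite rowK.
Qed.

Lemma fdual_eval2_linear h g : linear (fun t => fdual_eval2 t h g : k^o).
Proof. exact: tlift_linear (eval2_bilin h g). Qed.

Lemma fdual_eval2_eq0 (t : tensor fdual fdual) :
  (forall h g, fdual_eval2 t h g = 0) -> t = 0.
Proof.
rewrite (tensor_sum t) (big_nth (0, 0)) big_mkord.
set N := size _; set u := fun i => (nth (0, 0) (repr t) i).1.
set v := fun i => (nth (0, 0) (repr t) i).2 => ev0.
have lp : linear (fun h => \row_(i < N) u i h).
  by move=> a x y; apply/rowP => i; rewrite !mxE fdual_linear.
pose p : {linear H -> 'rV[k]_N} := HB.pack (fun h => \row_(i < N) u i h)
  (GRing.isLinear.Build _ _ _ _ _ lp).
have [m [s [q pq]]] := finite_test p.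
pose c j := \sum_(l < N) q l j *: u l.
have uE (i : 'I_N) : u i = \sum_(j < m) u i (s j) *: c j.
  apply: fdual_ext => h; rewrite fdual_sum.
  have := congr1 (fun w : 'rV_N => w 0 i) (pq h); rewrite /= mxE summxE => ->.
  apply: eq_bigr => j _; transitivity (u i (s j) * c j h); last by [].
  rewrite fdual_sum !mxE mulrC; congr (_ * _).
  by apply: eq_bigr => l _; rewrite mxE mulrC.
have w0 j : \sum_(i < N) u i (s j) *: v i = 0.
  apply: fdual_ext => g; rewrite fdual_sum fdual0 -[RHS](ev0 (s j) g).
  pose E : {linear tensor fdual fdual -> k^o} := HB.pack (fun t => fdual_eval2 t (s j) g : k^o)
    (GRing.isLinear.Build _ _ _ _ _ (@fdual_eval2_linear (s j) g)).
  rewrite -[RHS]/(E _) linear_sum /=; apply: eq_bigr => i _.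
  by rewrite /fdual_eval2 tlift_pure //; exact: eval2_bilin.
have [bl br] := @tpure_bilin k fdual fdual.
pose L w : {linear fdual -> tensor fdual fdual} := HB.pack ((@tpure k fdual fdual)^~ w)
  (GRing.isLinear.Build _ _ _ _ _ (bl w)).
pose R w : {linear fdual -> tensor fdual fdual} := HB.pack (@tpure k fdual fdual w)
  (GRing.isLinear.Build _ _ _ _ _ (br w)).
transitivity (\sum_(j < m) R (c j) (\sum_(i < N) u i (s j) *: v i)); last first.
  by rewrite big1 // => j _; rewrite w0 linear0.
rewrite (eq_bigr (fun i : 'I_N => \sum_(j < m) R (c j) (u i (s j) *: v i))).
  by rewrite exchange_big; apply: eq_bigr => j _; rewrite (linear_sum (R (c j))).
move=> i _; rewrite -[LHS]/(L (v i) (u i)) {1}uE linear_sum /=.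
apply: eq_bigr => j _; rewrite -[LHS]/(L (v i) _) -[RHS]/(R (c j) _).
by rewrite !linearZ.
Qed.

Lemma fdual_eval2_inj (s t : tensor fdual fdual) :
  (forall h g, fdual_eval2 s h g = fdual_eval2 t h g) -> s = t.
Proof.
move=> est; apply/eqP; rewrite -subr_eq0; apply/eqP/fdual_eval2_eq0 => h g.
by rewrite addrC -scaleN1r [LHS]fdual_eval2_linear est scaleN1r addNr.
Qed.

Lemma fdual_comul_exists (u : fdual) :
  exists t : tensor fdual fdual, forall h g, fdual_eval2 t h g = u (h * g).
Proof.
have /asboolP[lu [I [iI [n [p pP]] uI]]] := fdual_valP u.
have [m [s [q pq]]] := finite_test p.
have c_in i : ((fun h => (p h *m q) 0 i) : H -> k^o) \in fdual_pred.
  apply/asboolP; split.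
    by move=> a x y; rewrite linearP /= mulmxDl -scalemxAl !mxE.
  exists I; split=> //; first by exists n, p.
  by move=> h /pP ->; rewrite mul0mx mxE.
have v_in i : ((fun g => u (s i * g)) : H -> k^o) \in fdual_pred.
  apply/asboolP; split.
    by move=> a x y; rewrite mulrDr -scalerAr lu.
  exists I; split=> //; first by exists n, p.
  by move=> h Ih; apply: uI; have [_ /(_ (s i) h Ih)[]] := iI.
exists (\sum_(i < m) FDual (c_in i) \ox FDual (v_in i)) => h g.
pose uM := GRing.isLinear.Build _ _ _ _ _ lu.
pose ul : {linear H -> k^o} := HB.pack (fdual_val u) uM.
pose ev : {linear tensor fdual fdual -> k^o} :=
  HB.pack (tlift (fun u v : fdual => u h * v g : k^o))
    (GRing.isLinear.Build _ _ _ _ _ (tlift_linear (eval2_bilin h g))).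
rewrite [LHS](linear_sum ev) /=.
have dI : I (h - \sum_(i < m) (p h *m q) 0 i *: s i).
  apply/pP; rewrite linearB /= linear_sum /= {1}(pq h) -sumrB big1 // => i _.
  by rewrite linearZ /= subrr.
have /uI : I ((h - \sum_(i < m) (p h *m q) 0 i *: s i) * g).
  by have [_ /(_ g _ dI)[]] := iI.
rewrite mulrBl -[u _]/(ul _) linearB /= => /eqP; rewrite subr_eq0 => /eqP ->.
rewrite mulr_suml -[RHS]/(ul _) linear_sum /=; apply: eq_bigr => i _.
rewrite tlift_pure; last exact: eval2_bilin.
by rewrite -scalerAl -[RHS]/(ul _) linearZ.
Qed.

Definition fdual_comul (u : fdual) : tensor fdual fdual :=
  projT1 (cid (fdual_comul_exists u)).

Lemma fdual_comulE u h g : fdual_eval2 (fdual_comul u) h g = u (h * g).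
Proof. exact: (projT2 (cid (fdual_comul_exists u))). Qed.

End FiniteDual.

Section Subspaces.
Variables (k : fieldType) (V : lmodType k).

Definition findim (S : V -> Prop) : Prop :=
  exists s : seq V, (forall x, x \in s -> S x) /\
    forall v, S v -> exists c : nat -> k, v = \sum_(i < size s) c i *: s`_i.

Record subspace := Subspace {
  subspace_pred :> {pred V};
  subspaceP : submod_closed subspace_pred
}.

HB.instance Definition _ (S : subspace) :=
  GRing.isSubmodClosed.Build k V (subspace_pred S) (subspaceP S).

Record subspace_type (S : subspace) := SubspaceType {
  subspace_val : V;
  subspace_valP : subspace_val \in subspace_pred S
}.

HB.instance Definition _ S := [isSub for @subspace_val S].
HB.instance Definition _ S := [Choice of subspace_type S by <:].
HB.instance Definition _ S := [SubChoice_isSubLmodule of subspace_type S by <:].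

Definition is_basis n (e : 'I_n -> V) : Prop :=
  forall v, exists! c : 'rV[k]_n, v = \sum_(i < n) c 0 i *: e i.

End Subspaces.

Section Calculi.
Variables (k : fieldType) (H : hopfAlgType k).

Record qtspace := QTSpace {
  qt_space :> subspace (fdual H);
  qt_findim : findim (fun u => u \in qt_space);
  qt_plus : forall u : fdual H, u \in qt_space -> u 1 = 0;
  qt_comul : forall u : fdual H, u \in qt_space ->
    exists (v : subspace_type qt_space) (r : tensor (fdual H) (subspace_type qt_space)),
      fdual_comul u = \val v \ox fdual_counit H + \tsum_(f, x <- r) (f \ox \val x)
}.

Definition qt_type (g : qtspace) : lmodType k := subspace_type g.

Record bimodule (X : lmodType k) := Bimodule {
  lact : H -> X -> X;
  ract : X -> H -> X;
  lact_bilin : bilin lact;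
  ract_bilin : bilin ract;
  lact1 : forall x, lact 1 x = x;
  lactM : forall h g x, lact (h * g) x = lact h (lact g x);
  ract1 : forall x, ract x 1 = x;
  ractM : forall x h g, ract x (h * g) = ract (ract x h) g;
  lractA : forall h x g, ract (lact h x) g = lact h (ract x g)
}.

Record fovc (X : lmodType k) := Fovc {
  fovc_bimodule :> bimodule X;
  vecL : X -> {linear H -> H};
  vecL_linear : forall g, linear (fun x => vecL x g);
  vecL_inj : forall x y, vecL x =1 vecL y -> x = y;
  vecL_lact : forall h x g, vecL (lact fovc_bimodule h x) g = h * vecL x g;
  vecL_leibniz : forall x h g,
    vecL x (h * g) = vecL x h * g + vecL (ract fovc_bimodule x h) g
}.

Record cov_fovc (X : lmodType k) := CovFovc {
  cov_fovc_fovc :> fovc X;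
  coact : {linear X -> tensor H X};
  coactA : forall x,
    \tsum_(h, y <- coact x) \tsum_(a, b <- comul h) (a \ox (b \ox y)) =
    \tsum_(h, y <- coact x) (h \ox coact y);
  coact_counit : forall x, \tsum_(h, y <- coact x) (counit h *: y) = x;
  coact_bimodule : forall h x g,
    coact (ract cov_fovc_fovc (lact cov_fovc_fovc h x) g) =
    \tsum_(a, b <- comul h) \tsum_(y, z <- coact x) \tsum_(c, d <- comul g)
      ((a * y * c) \ox ract cov_fovc_fovc (lact cov_fovc_fovc b z) d);
  coact_vecL : forall x h, comul (vecL cov_fovc_fovc x h) =
    \tsum_(y, z <- coact x) \tsum_(a, b <- comul h) ((y * a) \ox vecL cov_fovc_fovc z b)
}.

Definition coinv (X : lmodType k) (C : cov_fovc X) (x : X) : Prop :=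
  coact C x = 1 \ox x.

Record fin_calculus := FinCalculus {
  calc_space : lmodType k;
  calc_fovc :> cov_fovc calc_space;
  calc_findim : findim (coinv calc_fovc)
}.

Definition calc_iso (C D : fin_calculus) : Prop :=
  exists phi : {linear calc_space C -> calc_space D},
    [/\ bijective phi,
        forall h x, phi (lact C h x) = lact D h (phi x),
        forall x h, phi (ract C x h) = ract D (phi x) h,
        forall x, coact D (phi x) = \tsum_(h, y <- coact C x) (h \ox phi y)
      & forall x, vecL D (phi x) =1 vecL C x].

Lemma tlift_comp (V W U U' : lmodType k) (b : V -> W -> U) (F : U -> U') t :
  linear F -> F (tlift b t) = tlift (fun v w => F (b v w)) t.
Proof.
move=> lF; pose Fl : {linear U -> U'} := HB.pack F (GRing.isLinear.Build _ _ _ _ _ lF).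
by rewrite -[LHS]/(Fl _) linear_sum.
Qed.

Lemma push_bilin (V W W' : lmodType k) (F : W -> W') :
  linear F -> bilin (fun (v : V) w => v \ox F w).
Proof.
have [bl br] := @tpure_bilin k V W'.
by move=> lF; split=> [w|v] a x y /=; [exact: bl|rewrite lF; exact: br].
Qed.

Lemma calc_iso_refl C : calc_iso C C.
Proof.
exists idfun; split=> //.
by move=> x; exact: tensor_sum.
Qed.

Lemma calc_iso_sym C D : calc_iso C D -> calc_iso D C.
Proof.
case=> phi [[psi phiK psiK] hl hr hc hL].
have lpsi : linear psi by move=> a x y; apply: (can_inj phiK); rewrite linearP !psiK.
pose psil : {linear calc_space D -> calc_space C} :=
  HB.pack psi (GRing.isLinear.Build _ _ _ _ _ lpsi).
exists psil; split=> [|h x|x h|x|x g] /=.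
- by exists phi.
- by apply: (can_inj phiK); rewrite hl !psiK.
- by apply: (can_inj phiK); rewrite hr !psiK.
- rewrite -{2}(psiK x) hc (tlift_comp _ _ (tlift_linear (push_bilin H lpsi))).
  rewrite [LHS]tensor_sum; congr tlift; apply/funext => h; apply/funext => y.
  by rewrite tlift_pure ?phiK //; exact: push_bilin.
- by rewrite -hL psiK.
Qed.

Lemma calc_iso_trans C D E : calc_iso C D -> calc_iso D E -> calc_iso C E.
Proof.
case=> phi [b1 hl hr hc hL] [psi [b2 hl' hr' hc' hL']].
have lpsi : linear psi by move=> a x y; rewrite linearP.
exists (psi \o phi); split=> [|h x|x h|x|x g] /=.
- exact: bij_comp.
- by rewrite hl hl'.
- by rewrite hr hr'.
- rewrite hc' hc (tlift_comp _ _ (tlift_linear (push_bilin H lpsi))).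
  congr tlift; apply/funext => h; apply/funext => y.
  by rewrite tlift_pure //; exact: push_bilin.
- by rewrite hL' hL.
Qed.

Definition calc_class : Type :=
  {P : fin_calculus -> Prop | exists C, P = calc_iso C}.

Definition class_of (C : fin_calculus) : calc_class :=
  exist _ (calc_iso C) (ex_intro _ C erefl).

Lemma class_ofP C D : class_of C = class_of D <-> calc_iso C D.
Proof.
split=> [/(congr1 (@proj1_sig _ _)) /= ->|CD]; first exact: calc_iso_refl.
apply: eq_exist; apply/funext => E; apply/propext; split.
  exact/calc_iso_trans/calc_iso_sym.
exact: calc_iso_trans.
Qed.

(* The structure maps of the calculus on H (x) g; they are given on pure
   tensors, which span. *)
Record is_tangent_calculus (g : qtspace) (C : cov_fovc (tensor H (qt_type g))) : Prop := {
  tangent_act : forall n (chi : 'I_n -> qt_type g) (f : 'I_n -> 'I_n -> fdual H),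
    is_basis chi ->
    (forall i, fdual_comul (\val (chi i)) =
       \val (chi i) \ox fdual_counit H + \sum_(j < n) f i j \ox \val (chi j)) ->
    forall h' h i x, ract C (lact C h' (h \ox chi i)) x =
      \sum_(j < n) (\tsum_(x1, x2 <- comul x) ((f i j x2 : k) *: (h' * h * x1))) \ox chi j;
  tangent_coact : forall h (chi : qt_type g),
    coact C (h \ox chi) = \tsum_(h1, h2 <- comul h) (h1 \ox (h2 \ox chi));
  tangent_vecL : forall h (chi : qt_type g) x,
    vecL C (h \ox chi) x = \tsum_(x1, x2 <- comul x) ((\val chi x2 : k) *: (h * x1))
}.

End Calculi.

(* Main.v *)
Require Import Defs.
From HB Require Import structures.
From mathcomp Require Import all_boot all_algebra.
From mathcomp Require Import boolp classical_sets functions.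

Set Implicit Arguments.
Unset Strict Implicit.
Unset Printing Implicit Defensive.

Import GRing.Theory.
Local Open Scope ring_scope.

(** A covariant calculus is recovered from the functionals eps o L_v, for v
    coinvariant, and a quantum tangent space g from the coinvariants 1 (x) g of
    H (x) g. In both directions the map L does the work: as soon as it is known
    to be injective, two elements of a calculus are compared by comparing the
    endomorphisms of H that they define.

    The calculus of g. Put L_(h (x) chi)(a) = h a_1 chi(a_2). The Leibniz rule
    prescribes L_(X . a), and the coproduct chi |-> chi (x) eps + f (x) chi'
    supplies an element of H (x) g with the prescribed image, so injectivity of
    L gives the right action, all the bimodule axioms and the formula for the
    action in terms of any basis of g.

    Injectivity of L (tangent_vec_inj) is the main point. Let L_X = 0 with
    X = sum_i h_i (x) chi_i and G(c) = sum_i h_i chi_i(c). If S were bijective,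
    evaluating L_X at c_2 and multiplying on the right by S^-1(c_1) would give
    G(c) = 0 at once. In general the antipode itself only gives
    G(S(x_1) ... S(x_j)) = 0 for all x and j (tangent_pair_antipode_pow). This
    suffices: G factors through a finite-dimensional quotient algebra of H, and
    convolution by S, restricted to a finite-dimensional space, is an
    automorphism whose inverse, convolution by the identity, is a polynomial
    in it. Hence each a is there a combination of the products S(a_1) ... S(a_j)
    (antipode_pow_dense), and G = 0. As g has a finite dual frame, X = 0.

    The tangent space of a calculus. The fundamental theorem of Hopf modules
    writes x = x_(-1) . P(x_0), where P(x) = S(x_(-1)) . x_0 is coinvariant. For
    coinvariant v, colinearity of L gives L_v(a) = a_1 chi_v(a_2) with
    chi_v = eps o L_v, and the Leibniz rule becomes
    chi_v(a b) = chi_v(a) eps(b) + chi_(P(v . a))(b). So eps and the functionals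
    chi_v span a finite-dimensional space which is stable under translations;
    such functionals belong to the finite dual (fdual_of_translates), and the
    chi_v form a quantum tangent space. The map h (x) chi_v |-> h . v is then
    compatible with L, hence an isomorphism of calculi. *)

(** * Linearity of maps written in Sweedler notation *)

Section LinearClosure.
Variables (k : fieldType) (U V W X : lmodType k).

Lemma linear_id : linear (fun x : U => x).
Proof. by []. Qed.

Lemma linearZE (F : U -> V) a x : linear F -> F (a *: x) = a *: F x.
Proof.
move=> lF; pose Fl : {linear U -> V} := HB.pack F (GRing.isLinear.Build _ _ _ _ _ lF).
by rewrite -[F _]/(Fl _) linearZ.
Qed.

Lemma linear0E (F : U -> V) : linear F -> F 0 = 0.
Proof. by move=> lF; rewrite -(scale0r (0 : U)) linearZE // scale0r. Qed.

Lemma linear_sumE (F : U -> V) I (r : seq I) (P : pred I) e : linear F ->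
  F (\sum_(i <- r | P i) e i) = \sum_(i <- r | P i) F (e i).
Proof.
move=> lF; pose Fl : {linear U -> V} := HB.pack F (GRing.isLinear.Build _ _ _ _ _ lF).
by rewrite -[LHS]/(Fl _) linear_sum.
Qed.

Lemma linear_cst0 : linear (fun _ : U => 0 : V).
Proof. by move=> a x y; rewrite scaler0 addr0. Qed.

Lemma linear_comp (F : V -> W) (e : U -> V) :
  linear F -> linear e -> linear (fun x => F (e x)).
Proof. by move=> lF le a x y; rewrite le lF. Qed.

Lemma linear_app (F : {linear V -> W}) (e : U -> V) :
  linear e -> linear (fun x => F (e x)).
Proof. by move=> le a x y; rewrite le linearP. Qed.

Lemma linear_sub (e f : U -> V) :
  linear e -> linear f -> linear (fun x => e x - f x).
Proof. by move=> le lf a x y; rewrite le lf scalerBr opprD addrACA. Qed.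

Lemma linear_scaler (a : k) (e : U -> V) : linear e -> linear (fun x => a *: e x).
Proof. by move=> le c x y; rewrite le scalerDr !scalerA [a * c]mulrC. Qed.

Lemma linear_scalel (e : U -> k^o) (v : V) :
  linear e -> linear (fun x => (e x : k) *: v).
Proof. by move=> le c x y; rewrite le scalerDl scalerA. Qed.

Lemma linear_tlift_body (b : U -> V -> W -> X) t :
  (forall v w, linear (fun x => b x v w)) ->
  linear (fun x => tlift (b x) t).
Proof.
move=> lb a x y; rewrite /tlift /tsum scaler_sumr -big_split.
by apply: eq_bigr => p _; exact: lb.
Qed.

Lemma linear_tlift_arg (b : V -> W -> X) (e : U -> tensor V W) :
  bilin b -> linear e -> linear (fun x => tlift b (e x)).
Proof. by move=> hb le a x y; rewrite le tlift_linear. Qed.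

Lemma linear_tpurel (e : U -> V) (w : W) :
  linear e -> linear (fun x => e x \ox w).
Proof. by move=> le a x y; have [bl _] := @tpure_bilin k V W; rewrite le bl. Qed.

Lemma linear_tpurer (e : U -> W) (v : V) :
  linear e -> linear (fun x => v \ox e x).
Proof. by move=> le a x y; have [_ br] := @tpure_bilin k V W; rewrite le br. Qed.

Lemma linear_bilinl (b : V -> W -> X) (e : U -> V) w :
  bilin b -> linear e -> linear (fun x => b (e x) w).
Proof. by case=> bl _ le a x y; rewrite le bl. Qed.

Lemma linear_bilinr (b : V -> W -> X) (e : U -> W) v :
  bilin b -> linear e -> linear (fun x => b v (e x)).
Proof. by case=> _ br le a x y; rewrite le br. Qed.

Lemma eq_tlift (b c : V -> W -> X) t :
  (forall v w, b v w = c v w) -> tlift b t = tlift c t.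
Proof. by move=> bc; apply: eq_bigr => p _; exact: bc. Qed.

Lemma tlift0_body (t : tensor V W) : tlift (fun _ _ => 0 : X) t = 0.
Proof. by rewrite /tlift /tsum big1. Qed.

Lemma tlift_scale_body (b : V -> W -> X) a t :
  tlift (fun v w => a *: b v w) t = a *: tlift b t.
Proof. by rewrite /tlift /tsum scaler_sumr. Qed.

Lemma tlift_add_body (b c : V -> W -> X) t :
  tlift (fun v w => b v w + c v w) t = tlift b t + tlift c t.
Proof. exact: big_split. Qed.

Lemma tensor_linear_eq (F G : tensor V W -> X) t : linear F -> linear G ->
  (forall v w, F (v \ox w) = G (v \ox w)) -> F t = G t.
Proof.
move=> lF lG FG; rewrite (tensor_sum t).
rewrite -/(tlift (fun v w => v \ox w) t) !tlift_comp //.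
exact: eq_tlift.
Qed.

Lemma tensor_ind (P : tensor V W -> Prop) :
  P 0 -> (forall s t, P s -> P t -> P (s + t)) -> (forall v w, P (v \ox w)) ->
  forall t, P t.
Proof. by move=> P0 PD Pp t; rewrite (tensor_sum t); apply: big_ind. Qed.

Lemma tlift_tpure (t : tensor V W) : \tsum_(v, w <- t) (v \ox w) = t.
Proof. by rewrite [RHS]tensor_sum. Qed.

End LinearClosure.

Lemma tlift_swap (k : fieldType) (V W V' W' X : lmodType k)
    (b : V -> W -> V' -> W' -> X) s t :
  \tsum_(v, w <- s) \tsum_(v', w' <- t) b v w v' w' =
  \tsum_(v', w' <- t) \tsum_(v, w <- s) b v w v' w'.
Proof. exact: exchange_big. Qed.

Definition qt_fun (k : fieldType) (H : hopfAlgType k) (g : qtspace H)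
  (x : qt_type g) (a : H) : k^o := \val x a.

Section LinearAlg.
Variables (k : fieldType) (U : lmodType k) (A : algType k) (H : hopfAlgType k).

Lemma linear_mull (e : U -> A) c : linear e -> linear (fun x => e x * c).
Proof. by move=> le a x y; rewrite le mulrDl scalerAl. Qed.

Lemma linear_mulr (e : U -> A) c : linear e -> linear (fun x => c * e x).
Proof. by move=> le a x y; rewrite le mulrDr scalerAr. Qed.

Lemma linear_counit (e : U -> H) : linear e -> linear (fun x => counit (e x) : k^o).
Proof. by move=> le a x y; rewrite le linearP. Qed.

Lemma linear_fdual (u : fdual H) (e : U -> H) : linear e -> linear (fun x => u (e x)).
Proof. by move=> le; exact: linear_comp (fdual_linear u) le. Qed.

Lemma linear_fdual_eval (e : U -> fdual H) h : linear e -> linear (fun x => e x h).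
Proof. by move=> le a x y; rewrite le fdualD fdualZ. Qed.

Lemma linear_qt_val (g : qtspace H) (e : U -> qt_type g) :
  linear e -> linear (fun x => \val (e x)).
Proof. by move=> le a x y; rewrite le. Qed.

Lemma linear_qt_funl (g : qtspace H) (e : U -> qt_type g) a :
  linear e -> linear (fun x => qt_fun (e x) a).
Proof. by move=> le c x y; rewrite le. Qed.

Lemma linear_qt_funr (g : qtspace H) (x : qt_type g) (e : U -> H) :
  linear e -> linear (fun a => qt_fun x (e a)).
Proof. exact: linear_fdual. Qed.

End LinearAlg.

(** Linearity in one variable of a Sweedler expression, by recursion on the
    expression; multilinearity is a side condition of every Sweedler rule. Sums
    over a tensor that does not mention the variable come before the general
    case, since they need no bilinearity of the summand. *)
Ltac lin :=
  intros; cbn beta;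
  lazymatch goal with
  | |- bilin _ => split; lin
  | |- _ => solve [ assumption | first
    [ exact: linear_id
    | exact: linear_cst0
    | apply: linear_counit; lin
    | apply: linear_fdual; lin
    | apply: linear_fdual_eval; lin
    | apply: linear_qt_val; lin
    | apply: linear_qt_funl; lin
    | apply: linear_qt_funr; lin
    | apply: linear_mull; lin
    | apply: linear_mulr; lin
    | apply: linear_scaler; lin
    | apply: linear_scalel; lin
    | apply: linear_tpurel; lin
    | apply: linear_tpurer; lin
    | apply: linear_tlift_body; lin
    | apply: linear_tlift_arg; lin
    | apply: linear_app; lin
    | match goal with
      | hb : bilin _ |- _ => apply: (linear_bilinl _ hb); lin
      | hb : bilin _ |- _ => apply: (linear_bilinr _ hb); lin
      | hl : _ |- _ => apply: (linear_comp hl); lin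
      | hl : _ |- _ => apply: (linear_comp (hl _)); lin
      | hl : _ |- _ => apply: (linear_comp (hl _ _)); lin
      end ] ]
  end.

(** * Sweedler calculus in a Hopf algebra *)

Section Sweedler.
Variables (k : fieldType) (H : hopfAlgType k).

Section Mod.
Variables (V : lmodType k).
Implicit Types (h g : H).

Lemma tlift_tlift (U1 U2 V1 V2 : lmodType k) (b : V1 -> V2 -> V)
   (c : U1 -> U2 -> tensor V1 V2) t : bilin b ->
  tlift b (tlift c t) = \tsum_(v, w <- t) tlift b (c v w).
Proof. by move=> hb; rewrite (tlift_comp _ _ (tlift_linear hb)). Qed.

(** The coassociativity axiom is an equation in H (x) (H (x) H); it is used
    through the trilinear maps that factor through this space. *)
Lemma sw_assoc (F : H -> H -> H -> V) h :
  (forall b c, linear (fun a => F a b c)) ->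
  (forall a c, linear (fun b => F a b c)) ->
  (forall a b, linear (fun c => F a b c)) ->
  \tsum_(a, b <- comul h) \tsum_(a1, a2 <- comul a) F a1 a2 b =
  \tsum_(a, b <- comul h) \tsum_(b1, b2 <- comul b) F a b1 b2.
Proof.
move=> l1 l2 l3.
have bF : bilin (fun a t => tlift (F a) t) by lin.
have := congr1 (tlift (fun a t => tlift (F a) t)) (comulA h).
rewrite !tlift_tlift // => e.
transitivity (\tsum_(v, w <- comul h) \tsum_(v0, w0 <- comul v) tlift (F v0) (w0 \ox w)).
  by apply: eq_tlift => a b; apply: eq_tlift => a1 a2; rewrite tlift_pure //; lin.
etransitivity; last first.
  apply: eq_tlift => a b.
  by rewrite -(tlift_pure a (comul b) bF).
rewrite -e; apply: eq_tlift => a b; rewrite tlift_tlift //.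
by apply: eq_tlift => a1 a2; rewrite !tlift_pure //; lin.
Qed.

Lemma sw_counitl (F : H -> V) h : linear F ->
  \tsum_(a, b <- comul h) (counit a *: F b) = F h.
Proof.
move=> lF; rewrite -[in RHS](comul_counitl h) (tlift_comp _ _ lF).
by apply: eq_tlift => a b; rewrite linearZE.
Qed.

Lemma sw_counitr (F : H -> V) h : linear F ->
  \tsum_(a, b <- comul h) (counit b *: F a) = F h.
Proof.
move=> lF; rewrite -[in RHS](comul_counitr h) (tlift_comp _ _ lF).
by apply: eq_tlift => a b; rewrite linearZE.
Qed.

Lemma sw_antipodel (F : H -> V) h : linear F ->
  \tsum_(a, b <- comul h) F (antipode a * b) = counit h *: F 1.
Proof.
move=> lF; rewrite -(linearZE _ _ lF) -antipodel.
by rewrite (tlift_comp _ _ lF).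
Qed.

Lemma sw_antipoder (F : H -> V) h : linear F ->
  \tsum_(a, b <- comul h) F (a * antipode b) = counit h *: F 1.
Proof.
move=> lF; rewrite -(linearZE _ _ lF) -antipoder.
by rewrite (tlift_comp _ _ lF).
Qed.

Lemma sw_mul (b : H -> H -> V) h g : bilin b ->
  tlift b (comul (h * g)) =
  \tsum_(h1, h2 <- comul h) \tsum_(g1, g2 <- comul g) b (h1 * g1) (h2 * g2).
Proof.
move=> hb; rewrite comulM tlift_tlift //; apply: eq_tlift => h1 h2.
rewrite tlift_tlift //; apply: eq_tlift => g1 g2; exact: tlift_pure.
Qed.

Lemma sw_1 (b : H -> H -> V) : bilin b -> tlift b (comul 1) = b 1 1.
Proof. by move=> hb; rewrite comul1 tlift_pure. Qed.

End Mod.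

(** Both sides are convolution inverses of comul, as maps from H to the algebra
    H (x) H, whose product is m2: the left side because comul is multiplicative,
    the right side by x_1 S(x_4) (x) x_2 S(x_3) = eps(x) 1 (x) 1. *)
Lemma comul_antipode (x : H) :
  comul (antipode x) = \tsum_(a, b <- comul x) (antipode b \ox antipode a).
Proof.
pose m2 (s t : tensor H H) : tensor H H :=
  \tsum_(a, b <- s) \tsum_(c, d <- t) ((a * c) \ox (b * d)).
have m2bil : bilin m2 by rewrite /m2; lin.
have m2M h g : comul (h * g) = m2 (comul h) (comul g) by exact: comulM.
have m2p a b c d : m2 (a \ox b) (c \ox d) = (a * c) \ox (b * d).
  by rewrite /m2 !tlift_pure //; lin.
have m2A r s t : m2 (m2 r s) t = m2 r (m2 s t).
  apply: (tensor_linear_eq (F := fun r => m2 (m2 r s) t)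
            (G := fun r => m2 r (m2 s t))); [lin..|move=> a b].
  apply: (tensor_linear_eq (F := fun s => m2 (m2 (a \ox b) s) t)
            (G := fun s => m2 (a \ox b) (m2 s t))); [lin..|move=> c d].
  apply: (tensor_linear_eq (F := fun t => m2 (m2 (a \ox b) (c \ox d)) t)
            (G := fun t => m2 (a \ox b) (m2 (c \ox d) t))); [lin..|move=> e f].
  by rewrite !m2p !mulrA.
have m21 s : m2 (1 \ox 1) s = s.
  apply: (tensor_linear_eq (F := fun s => m2 (1 \ox 1) s) (G := fun s => s));
    [lin..|move=> a b].
  by rewrite m2p !mul1r.
have m2r s : m2 s (1 \ox 1) = s.
  apply: (tensor_linear_eq (F := fun s => m2 s (1 \ox 1)) (G := fun s => s));
    [lin..|move=> a b].
  by rewrite m2p !mulr1.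
pose R (y : H) := \tsum_(a, b <- comul y) (antipode b \ox antipode a).
have lR : linear R by rewrite /R; lin.
have RV y : \tsum_(a, b <- comul y) m2 (comul a) (R b) = counit y *: (1 \ox 1).
  transitivity (\tsum_(a, b <- comul y) \tsum_(a1, a2 <- comul a)
       \tsum_(b1, b2 <- comul b) ((a1 * antipode b2) \ox (a2 * antipode b1))).
    apply: eq_tlift => a b; rewrite {1}/m2; apply: eq_tlift => a1 a2.
    rewrite tlift_tlift; last by lin.
    by apply: eq_tlift => b1 b2; rewrite tlift_pure //; lin.
  rewrite sw_assoc; [|lin..].
  rewrite -(sw_antipoder (F := fun z => z \ox 1)); last by lin.
  apply: eq_tlift => a z.
  rewrite -(sw_assoc (F := fun b c d => (a * antipode d) \ox (b * antipode c))); [|lin..].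
  rewrite -(sw_counitl (F := fun d => (a * antipode d) \ox 1)); last by lin.
  apply: eq_tlift => w d.
  by rewrite (sw_antipoder (F := fun b => (a * antipode d) \ox b)) //; lin.
rewrite -(sw_counitr (F := fun y => comul (antipode y))); last by lin.
transitivity (\tsum_(a, b <- comul x) m2 (comul (antipode a))
   (\tsum_(c, d <- comul b) m2 (comul c) (R d))).
  apply: eq_tlift => a b; rewrite RV linearZE ?m2r //; lin.
transitivity (\tsum_(a, b <- comul x) \tsum_(c, d <- comul b)
   m2 (m2 (comul (antipode a)) (comul c)) (R d)).
  apply: eq_tlift => a b; rewrite tlift_comp; last by lin.
  by apply: eq_tlift => c d; rewrite m2A.
rewrite -sw_assoc; [|lin..].
rewrite -[RHS]/(R x) -[RHS](sw_counitl (F := R)) //; apply: eq_tlift => a b.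
transitivity (\tsum_(c, d <- comul a) m2 (comul (antipode c * d)) (R b)).
  by apply: eq_tlift => c d; rewrite m2M.
rewrite (sw_antipodel (F := fun z => m2 (comul z) (R b))); last by lin.
by rewrite comul1 m21.
Qed.

Lemma sw_antipode (V : lmodType k) (b : H -> H -> V) h : bilin b ->
  tlift b (comul (antipode h)) = \tsum_(h1, h2 <- comul h) b (antipode h2) (antipode h1).
Proof.
move=> hb; rewrite comul_antipode tlift_tlift //; apply: eq_tlift => h1 h2.
exact: tlift_pure.
Qed.

End Sweedler.

(** * Convolution powers of the antipode *)

(** The coefficients come from the first nonzero entry of a linear relation
    between more than #|I| of the vectors w j. *)
Lemma span_recurrence (k : fieldType) (V : lmodType k) (I : finType)
    (e : I -> V) (w : nat -> V) (C : nat -> I -> k) :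
  (forall j, w j = \sum_i C j i *: e i) ->
  exists j0 m (c : 'I_m -> k), w j0 = \sum_(i < m) c i *: w (j0.+1 + i)%N.
Proof.
move=> wE; pose N := #|I|.
pose M : 'M[k]_(N.+1, N) := \matrix_(j, i) C j (enum_val i).
have /rowV0Pn[v /sub_kermxP vM vn0] : kermx M != 0.
  by rewrite kermx_eq0 /row_free neq_ltn (leq_ltn_trans (rank_leq_col _)).
have vw : \sum_(j < N.+1) v 0 j *: w j = 0.
  under eq_bigr do rewrite wE scaler_sumr.
  rewrite exchange_big big1 // => i _; under eq_bigr do rewrite scalerA.
  rewrite -scaler_suml; have := congr1 (fun A : 'rV_N => A 0 (enum_rank i)) vM.
  rewrite !mxE; under eq_bigr do rewrite mxE enum_rankK.
  by move=> ->; rewrite scale0r.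
have [j1 vj1] : exists j, v 0 j != 0.
  by have /rV0Pn[j] := vn0; exists j.
(* The least index j0 occurring in the relation v is the one solved for. *)
pose P j := (j < N.+1)%N && (v 0 (inord j) != 0).
have exP : exists j, P j by exists (val j1); rewrite /P ltn_ord inord_val.
case: (ex_minnP exP) => j0 /andP[j0N vj0] minj0.
exists j0, (N - j0)%N, (fun i => - (v 0 (inord j0))^-1 * v 0 (inord (j0.+1 + i))).
pose F j := v 0 (inord j) *: w j.
have FE : \sum_(0 <= j < N.+1) F j = 0.
  by rewrite big_mkord -[RHS]vw; apply: eq_bigr => j _; rewrite /F inord_val.
have F0 : \sum_(0 <= j < j0) F j = 0.
  rewrite big_nat_cond big1 // => j /andP[/andP[_ jj0] _].
  apply/eqP; rewrite scaler_eq0; apply/orP; left; apply/negPn/negP => vj.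
  have := minj0 j; rewrite /P vj (ltn_trans jj0 j0N) => /(_ isT).
  by rewrite leqNgt jj0.
have : F j0 + \sum_(j0.+1 <= j < N.+1) F j = 0.
  rewrite -big_ltn // -[LHS]add0r -{1}F0 -big_cat_nat //; exact: ltnW.
rewrite {1}/F => /eqP; rewrite addr_eq0 => /eqP e0.
apply: (scalerI vj0); rewrite e0 scaler_sumr -sumrN.
rewrite -{1}[j0.+1]add0n big_addn subSS big_mkord; apply: eq_bigr => i _.
by rewrite /F scalerA mulrA mulrN divff // mulN1r scaleNr addnC.
Qed.

Section AntipodePowers.
Variables (k : fieldType) (H : hopfAlgType k).

(** The j-th convolution power of the antipode, S(x_1) ... S(x_j). *)
Fixpoint antipode_pow (j : nat) (x : H) : H :=
  if j is j'.+1 then \tsum_(a, b <- comul x) (antipode a * antipode_pow j' b)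
  else (counit x)%:A.

Lemma antipode_pow_linear j : linear (antipode_pow j).
Proof.
elim: j => [|j IH] /=; first by apply: linear_scalel; apply: linear_counit.
by apply: linear_tlift_arg; lin.
Qed.

Lemma antipode_powV j x :
  \tsum_(a, b <- comul x) (antipode_pow j.+1 a * b) = antipode_pow j x.
Proof.
elim: j x => [|j IH] x.
  rewrite /= -antipodel; apply: eq_tlift => a b.
  congr (_ * _); rewrite -[RHS](sw_counitr (F := antipode)); last by lin.
  by apply: eq_tlift => x1 x2; rewrite -scalerAr mulr1.
have lp := antipode_pow_linear.
transitivity (\tsum_(a, b <- comul x) \tsum_(a1, a2 <- comul a)
   (antipode a1 * (antipode_pow j.+1 a2 * b))).
  apply: eq_tlift => a b; rewrite [antipode_pow _ _]/=.
  rewrite (tlift_comp _ (F := fun z => z * b)); last by lin.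
  by apply: eq_tlift => a1 a2; rewrite mulrA.
rewrite sw_assoc; [|lin..]; rewrite [RHS]/=; apply: eq_tlift => a b.
by rewrite -(IH b) (tlift_comp _ (F := fun z => antipode a * z)) //; lin.
Qed.

Variables (U : lmodType k) (act : U -> H -> U).
Hypotheses (act_bilin : bilin act)
  (actM : forall v a b, act v (a * b) = act (act v a) b).

(** In a right H-module, with u H finite-dimensional, put
    w_j = u S(a_1) ... S(a_j) (x) a_(j+1). These tensors span a finite-dimensional
    space, so some w_j0 is a combination of the later ones. The operator
    T : v (x) d |-> v d_1 (x) d_2 sends w_(j+1) to w_j and w_0 to u a_1 (x) a_2;
    applying T^(j0+1) to the relation and id (x) eps to the result expresses u a
    through the u S(a_1) ... S(a_j). *)
Lemma antipode_pow_dense (I : finType) (e : I -> U) (f : I -> H -> k^o) u a :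
  (forall i, linear (f i)) -> (forall b, act u b = \sum_i f i b *: e i) ->
  exists m (c : 'I_m -> k), act u a = \sum_(j < m) c j *: act u (antipode_pow j a).
Proof.
move=> lf fE; have lp := antipode_pow_linear.
pose w j : tensor U H := \tsum_(x, y <- comul a) (act u (antipode_pow j x) \ox y).
pose T (t : tensor U H) : tensor U H :=
  \tsum_(v, d <- t) \tsum_(d1, d2 <- comul d) (act v d1 \ox d2).
pose ev (t : tensor U H) : U := \tsum_(v, d <- t) (counit d *: v).
have lT : linear T by rewrite /T; lin.
have lev : linear ev by rewrite /ev; lin.
have Tw j : T (w j) = \tsum_(x, y <- comul a) \tsum_(d1, d2 <- comul y)
     (act u (antipode_pow j x * d1) \ox d2).
  rewrite /T /w tlift_tlift; last by lin.
  apply: eq_tlift => x y; rewrite tlift_pure; last by lin.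
  by apply: eq_tlift => d1 d2; rewrite actM.
have TwS j : T (w j.+1) = w j.
  rewrite Tw -sw_assoc; [|lin..]; apply: eq_tlift => x y.
  by rewrite -antipode_powV (tlift_comp _ (F := fun z => act u z \ox y)) //; lin.
have evw j : ev (w j) = act u (antipode_pow j a).
  rewrite /ev /w tlift_tlift; last by lin.
  rewrite -(sw_counitr (F := fun a => act u (antipode_pow j a))); last by lin.
  by apply: eq_tlift => x y; rewrite tlift_pure //; lin.
have evT : ev (T (w 0%N)) = act u a.
  rewrite Tw /ev tlift_tlift; last by lin.
  rewrite -(sw_counitl (F := act u)); last by lin.
  apply: eq_tlift => x y; rewrite tlift_tlift; last by lin.
  rewrite -linearZE; last by lin.
  rewrite -[counit x *: y]mul1r -scalerAr scalerAl.
  rewrite -(sw_counitr (F := fun y => act u ((counit x)%:A * y))); last by lin.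
  by apply: eq_tlift => y1 y2; rewrite tlift_pure //; lin.
pose r := repr (comul a); pose p i := nth (0, 0) r i.
have [|j0 [m [c w0E]]] := @span_recurrence _ _ (I * 'I_(size r))%type
   (fun q => e q.1 \ox (p q.2).2) w
   (fun j q => f q.1 (antipode_pow j (p q.2).1)).
  move=> j; rewrite -(pair_bigA _ (fun i (l : 'I_(size r)) => (f i (antipode_pow j (p l).1) : k) *:
    (e i \ox (p l).2))) exchange_big /=.
  rewrite /w /tlift /tsum (big_nth (0, 0)) big_mkord; apply: eq_bigr => l _.
  rewrite fE (linear_sumE (F := fun v => v \ox _)); last by lin.
  by apply: eq_bigr => i _; rewrite (linearZE (F := fun v => v \ox _)) //; lin.
have lTi n : linear (iter n T).
  by elim: n => [|n IH]; [lin|move=> b x y /=; rewrite IH lT].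
have Twi n j : iter n T (w (n + j)%N) = w j.
  by elim: n => // n IH; rewrite addSn iterSr TwS.
exists m, c.
rewrite -evT -{1}(Twi j0 0%N) addn0 -iterS w0E.
rewrite (linear_sumE (F := iter j0.+1 T)) // (linear_sumE (F := ev)) //.
apply: eq_bigr => i _; rewrite (linearZE (F := iter j0.+1 T)) //.
by rewrite (linearZE (F := ev)) // Twi evw.
Qed.

End AntipodePowers.

Section AntipodePowersSeparate.
Variables (k : fieldType) (H : hopfAlgType k) (V : lmodType k).

Lemma linear_pred_submod :
  submod_closed [pred F : H -> V | `[< linear F >]].
Proof.
split; first by apply/asboolP => a x y; rewrite /= scaler0 addr0.
move=> c F G /asboolP lF /asboolP lG; apply/asboolP => a x y; rewrite !fctE.
by rewrite lF lG !scalerDr !scalerA mulrC addrACA.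
Qed.

(** The right H-module here is the space of linear maps H -> V, with
    (F b)(x) = F (b x), and the vector u is G; the finite expansion of G (b x)
    says that its orbit is finite-dimensional. *)
Lemma antipode_pow_separates (I : finType) (G : H -> V) (f : I -> H -> k^o)
    (e : I -> H -> V) :
  linear G -> (forall i, linear (f i)) -> (forall i, linear (e i)) ->
  (forall b x, G (b * x) = \sum_i (f i b : k) *: e i x) ->
  (forall j a, G (antipode_pow j a) = 0) -> forall a, G a = 0.
Proof.
move=> lG lf le GE G0 a.
pose L := Subspace linear_pred_submod.
have inL F : linear F -> F \in subspace_pred L by move=> lF; apply/asboolP.
have linL (F : subspace_type L) : linear (\val F).
  by have /asboolP := subspace_valP F.
have lact b (F : subspace_type L) : linear (fun x => \val F (b * x)).
  by apply: (linear_comp (linL F)); lin.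
pose act (F : subspace_type L) b : subspace_type L := SubspaceType (inL _ (lact b F)).
have act_bilin : bilin act.
  split=> [b c F F'|F c b b']; apply: val_inj; apply/funext => x //=.
  by rewrite mulrDl -scalerAl linL.
have actM F b c : act F (b * c) = act (act F b) c.
  by apply: val_inj; apply/funext => x /=; rewrite mulrA.
pose u := SubspaceType (inL _ lG).
have uE b : act u b = \sum_i (f i b : k) *: SubspaceType (inL _ (le i)).
  apply: val_inj; apply/funext => x; rewrite linear_sumE // fct_sumE /=.
  exact: GE.
have [m [c]] := antipode_pow_dense act_bilin actM a lf uE.
move=> /(congr1 (fun F : subspace_type L => \val F 1)) /=.
rewrite mulr1 => ->; rewrite linear_sumE // fct_sumE big1 // => i _.
by rewrite /= !fctE mulr1 G0 scaler0.
Qed.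

End AntipodePowersSeparate.

(** * Dual frames and the product rule of a quantum tangent space *)

(** Finitely many points s_i separate the elements of a finite-dimensional space
    of functionals; the c_i are read off from values at these points, without
    choosing a basis. *)
Lemma fdual_dual_frame (k : fieldType) (H : hopfAlgType k) (S : subspace (fdual H)) :
  findim (fun u => u \in S) ->
  exists m (s : 'I_m -> H) (c : 'I_m -> fdual H), (forall i, c i \in S) /\
    forall x : fdual H, x \in S -> x = \sum_(i < m) (x (s i) : k) *: c i.
Proof.
case=> s [sS Ss]; pose n := size s; pose e (i : 'I_n) := s`_i.
have lp : linear (fun h => \row_(i < n) e i h).
  by move=> a x y; apply/rowP => i; rewrite !mxE fdual_linear.
pose p : {linear H -> 'rV[k]_n} := HB.pack (fun h => \row_(i < n) e i h)
  (GRing.isLinear.Build _ _ _ _ _ lp).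
have [m [t [q pq]]] := finite_test p.
pose c j : fdual H := \sum_(l < n) q l j *: e l.
have eE i : e i = \sum_(j < m) (e i (t j) : k) *: c j.
  apply: fdual_ext => h; rewrite fdual_sum.
  transitivity (p h 0 i); first by rewrite mxE.
  rewrite (pq h) summxE; apply: eq_bigr => j _.
  rewrite fdualZ fdual_sum !mxE mulrC; congr (_ * _); apply: eq_bigr => l _.
  by rewrite fdualZ mxE mulrC.
exists m, t, c; split=> [j|x /Ss[b ->]].
  by apply: rpred_sum => l _; apply/rpredZ/sS/mem_nth.
transitivity (\sum_(i < n) \sum_(j < m) b i *: ((e i (t j) : k) *: c j)).
  by apply: eq_bigr => i _; rewrite -scaler_sumr -eE.
rewrite exchange_big; apply: eq_bigr => j _ /=.
by rewrite fdual_sum scaler_suml; apply: eq_bigr => i _; rewrite fdualZ scalerA.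
Qed.

Section DualFrame.
Variables (k : fieldType) (H : hopfAlgType k) (g : qtspace H).

Lemma qt_dual_frame : exists m (s : 'I_m -> H) (c : 'I_m -> qt_type g),
  forall x : qt_type g, x = \sum_(i < m) (qt_fun x (s i) : k) *: c i.
Proof.
have [m [s [c [cg frame]]]] := fdual_dual_frame (qt_findim g).
exists m, s, (fun i => SubspaceType (cg i)) => x.
apply: val_inj; rewrite [LHS](frame _ (subspace_valP x)) linear_sumE; last by lin.
by apply: eq_bigr => i _; rewrite linearZE //; lin.
Qed.

Lemma qt_fun1 (x : qt_type g) : qt_fun x 1 = 0.
Proof. exact: qt_plus (subspace_valP x). Qed.

(** The first term of the coproduct is x itself: put b = 1 in the product rule,
    where the elements of the tangent space vanish. *)
Lemma qt_mul (x : qt_type g) : exists r : tensor (fdual H) (qt_type g),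
  forall a b, qt_fun x (a * b) =
    qt_fun x a * counit b + \tsum_(f, y <- r) (fdual_val f a * qt_fun y b : k^o).
Proof.
have [v [r xE]] := qt_comul (subspace_valP x); exists r.
have ev a b : qt_fun x (a * b) =
    qt_fun v a * counit b + \tsum_(f, y <- r) (fdual_val f a * qt_fun y b : k^o).
  rewrite /qt_fun -fdual_comulE xE /fdual_eval2.
  have lE := tlift_linear (eval2_bilin a b).
  rewrite -[X in X + _]scale1r lE scale1r tlift_pure; last exact: eval2_bilin.
  congr (_ + _); rewrite tlift_comp //; apply: eq_tlift => f y.
  by rewrite tlift_pure //; exact: eval2_bilin.
move=> a b; rewrite ev; congr (_ * _ + _).
have := ev a 1; rewrite mulr1 counit1 mulr1 => ->.
rewrite (_ : tlift _ _ = 0) ?addr0 //.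
rewrite -[RHS](tlift0_body k^o r); apply: eq_tlift => f y.
by rewrite qt_fun1 mulr0.
Qed.

Lemma qt_mul_frame m (s : 'I_m -> H) (c : 'I_m -> qt_type g) :
  (forall x : qt_type g, x = \sum_(i < m) (qt_fun x (s i) : k) *: c i) ->
  forall (x : qt_type g) a b, qt_fun x (a * b) = qt_fun x a * counit b +
    \sum_(i < m) (qt_fun x (a * s i) - qt_fun x a * counit (s i)) * qt_fun (c i) b.
Proof.
move=> frame x a b; have [r rE] := qt_mul x; rewrite rE; congr (_ + _).
under eq_bigr do rewrite rE addrC addKr.
rewrite /tlift /tsum; under [RHS]eq_bigr do rewrite mulr_suml.
rewrite exchange_big; apply: eq_bigr => p _ /=.
rewrite {1}(frame p.2) (linear_sumE (F := fun x => qt_fun x b)); last by lin.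
rewrite mulr_sumr; apply: eq_bigr => i _.
by rewrite (linearZE (F := fun x => qt_fun x b)); [rewrite mulrA|lin].
Qed.

End DualFrame.

(** * Injectivity of the map L on H (x) g *)

Section TangentAction.
Variables (k : fieldType) (H : hopfAlgType k) (g : qtspace H).

(** For X = h (x) x this is h y x(c): the endomorphism L_X evaluated on a formal
    tensor y (x) c in place of a coproduct. *)
Definition tangent_pair (X : tensor H (qt_type g)) (y c : H) : H :=
  \tsum_(h, x <- X) ((qt_fun x c : k) *: (h * y)).

Definition tangent_vec (X : tensor H (qt_type g)) (a : H) : H :=
  \tsum_(a1, a2 <- comul a) tangent_pair X a1 a2.

Lemma tangent_pair_bilin X : bilin (tangent_pair X).
Proof. by rewrite /tangent_pair; lin. Qed.

Lemma tangent_pair_linear y c : linear (fun X => tangent_pair X y c).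
Proof. by rewrite /tangent_pair; lin. Qed.

Lemma tangent_vecl a : linear (fun X => tangent_vec X a).
Proof. have l := tangent_pair_linear; rewrite /tangent_vec; lin. Qed.

Lemma tangent_vecr X : linear (tangent_vec X).
Proof. have l := tangent_pair_bilin; rewrite /tangent_vec; lin. Qed.

Lemma tangent_vec_pure h x a :
  tangent_vec (h \ox x) a = \tsum_(a1, a2 <- comul a) ((qt_fun x a2 : k) *: (h * a1)).
Proof.
by apply: eq_tlift => a1 a2; rewrite /tangent_pair tlift_pure //; lin.
Qed.

(** Induction on j. Since Delta(S(x_1)) (x_2 (x) 1) = 1 (x) S(x), a factor S(x)
    in the right slot is absorbed in the coproduct of b S(x_1), at the price of
    the factor x_2 in the left slot; z makes room for these factors. *)
Lemma tangent_pair_antipode_pow X j : (forall a, tangent_vec X a = 0) ->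
  forall a b z, \tsum_(b1, b2 <- comul b) tangent_pair X (b1 * z) (b2 * antipode_pow j a) = 0.
Proof.
move=> X0; have lp := tangent_pair_bilin X; have la := antipode_pow_linear.
elim: j => [|j IH] a b z.
  have -> : 0 = counit a *: (tangent_vec X b * z) by rewrite X0 mul0r scaler0.
  rewrite /tangent_vec (tlift_comp _ (F := fun y => counit a *: (y * z))); last by lin.
  apply: eq_tlift => b1 b2 /=.
  rewrite -scalerAr mulr1 (linearZE (F := tangent_pair X _)); last by lin.
  congr (_ *: _); rewrite /tangent_pair (tlift_comp _ (F := fun y => y * z)); last by lin.
  by apply: eq_tlift => h x; rewrite -scalerAl mulrA.
transitivity (\tsum_(a1, a2 <- comul a) \tsum_(c1, c2 <- comul a1)
  \tsum_(b1, b2 <- comul (b * antipode c1))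
    tangent_pair X (b1 * (c2 * z)) (b2 * antipode_pow j a2)).
  transitivity (\tsum_(a1, a2 <- comul a) \tsum_(b1, b2 <- comul b)
      tangent_pair X (b1 * z) (b2 * (antipode a1 * antipode_pow j a2))).
    rewrite tlift_swap; apply: eq_tlift => b1 b2; rewrite [antipode_pow _ _]/=.
    by rewrite (tlift_comp _ (F := fun y => tangent_pair X (b1 * z) (b2 * y))) //; lin.
  apply: eq_tlift => a1 a2.
  transitivity (\tsum_(b1, b2 <- comul b) \tsum_(c1, c2 <- comul a1)
    \tsum_(d1, d2 <- comul c1) tangent_pair X (b1 * (antipode d2 * c2) * z)
      (b2 * (antipode d1 * antipode_pow j a2))).
    apply: eq_tlift => b1 b2; rewrite sw_assoc; [|lin..].
    rewrite -(sw_counitr (F := fun d => tangent_pair X (b1 * z)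
      (b2 * (antipode d * antipode_pow j a2)))); last by lin.
    apply: eq_tlift => d1 y.
    rewrite (sw_antipodel (F := fun w => tangent_pair X (b1 * w * z) _)) ?mulr1 //.
    by lin.
  rewrite tlift_swap; apply: eq_tlift => c1 c2; rewrite sw_mul; last by lin.
  apply: eq_tlift => b1 b2; rewrite sw_antipode; last by lin.
  by apply: eq_tlift => d1 d2; rewrite !mulrA.
rewrite -[RHS](tlift0_body _ (comul a)); apply: eq_tlift => a1 a2.
rewrite -[RHS](tlift0_body _ (comul a1)); apply: eq_tlift => c1 c2.
exact: IH.
Qed.

Lemma tangent_vec_inj0 X : (forall a, tangent_vec X a = 0) -> X = 0.
Proof.
move=> X0; have lp := tangent_pair_bilin X.
pose G := tangent_pair X 1.
have lG : linear G by rewrite /G; lin.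
have [m [s [c frame]]] := qt_dual_frame g.
pose r := repr X; pose p i := nth (0, 0) r i; pose L := size r.
have XE : X = \sum_(l < L) (p l).1 \ox (p l).2.
  by rewrite [LHS]tensor_sum (big_nth (0, 0)) big_mkord.
have GE b : G b = \sum_(l < L) (qt_fun (p l).2 b : k) *: (p l).1.
  rewrite /G /tangent_pair /tlift /tsum (big_nth (0, 0)) big_mkord.
  by apply: eq_bigr => l _; rewrite mulr1.
pose f (i : 'I_L * 'I_m + 'I_L) b : k^o := match i with
  | inl (l, i) => qt_fun (p l).2 (b * s i) - qt_fun (p l).2 b * counit (s i)
  | inr l => qt_fun (p l).2 b end.
pose e (i : 'I_L * 'I_m + 'I_L) b : H := match i with
  | inl (l, i) => (qt_fun (c i) b : k) *: (p l).1
  | inr l => counit b *: (p l).1 end.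
have lf i : linear (f i).
  case: i => [[l i]|l] /=; last by lin.
  rewrite /f; apply: linear_sub; first by lin.
  apply: linear_mull; lin.
have le i : linear (e i) by case: i => [[l i]|l] /=; lin.
(* The finite expansion of G (b x) is the product rule in the dual frame. *)
have G0 a : G a = 0.
  apply: (antipode_pow_separates lG lf le) => [b x|j b].
    transitivity (\sum_(l < L) (\sum_(i < m) (f (inl (l, i)) b : k) *: e (inl (l, i)) x +
        (f (inr l) b : k) *: e (inr l) x)); last first.
      rewrite big_split pair_bigA big_sumType; congr (_ + _).
      by apply: eq_bigr => [[l i] _].
    rewrite GE; apply: eq_bigr => l _.
    rewrite (qt_mul_frame frame) addrC scalerDl scaler_suml; congr (_ + _).
      by apply: eq_bigr => i _; rewrite /f /e scalerA.
    by rewrite scalerA.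
  have := tangent_pair_antipode_pow j X0 b 1 1.
  by rewrite sw_1 ?mulr1 ?mul1r //; lin.
have -> : X = \sum_(i < m) G (s i) \ox c i.
  rewrite {1}XE.
  rewrite (eq_bigr (fun l : 'I_L =>
    \sum_(i < m) ((qt_fun (p l).2 (s i) : k) *: (p l).1) \ox c i)).
    rewrite exchange_big; apply: eq_bigr => i _.
    by rewrite GE (linear_sumE (F := fun h => h \ox c i)) //; lin.
  move=> l _; rewrite {1}(frame (p l).2) linear_sumE; last by lin.
  apply: eq_bigr => i _; rewrite linearZE; last by lin.
  by rewrite (linearZE (F := fun h => h \ox c i)) //; lin.
rewrite big1 // => i _; rewrite G0.
by rewrite -(scale0r (1 : H)) (linearZE (F := fun h : H => h \ox c i)) ?scale0r //; lin.
Qed.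

Lemma tangent_vec_inj X Y : tangent_vec X =1 tangent_vec Y -> X = Y.
Proof.
move=> XY; apply/eqP; rewrite -subr_eq0; apply/eqP/tangent_vec_inj0 => a.
have l := tangent_vecl a.
rewrite -scaleN1r addrC l XY scaleN1r addNr //.
Qed.

End TangentAction.

(** * The covariant calculus on H (x) g *)

Section TangentCalculus.
Variables (k : fieldType) (H : hopfAlgType k) (g : qtspace H).
Notation T := (tensor H (qt_type g)).

Definition tangent_lact (h : H) (X : T) : T := \tsum_(h', x <- X) ((h * h') \ox x).

Lemma tangent_lact_bilin : bilin tangent_lact.
Proof. by rewrite /tangent_lact; lin. Qed.

Lemma tangent_lact_pure h h' x : tangent_lact h (h' \ox x) = (h * h') \ox x.
Proof. by rewrite /tangent_lact tlift_pure //; lin. Qed.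

Lemma tangent_vec_lact h X a : tangent_vec (tangent_lact h X) a = h * tangent_vec X a.
Proof.
have lv := @tangent_vecl _ _ g; have lb := tangent_lact_bilin.
apply: (tensor_linear_eq (F := fun X => tangent_vec (tangent_lact h X) a)
  (G := fun X => h * tangent_vec X a)); [lin..|move=> h' x].
rewrite tangent_lact_pure !tangent_vec_pure (tlift_comp _ (F := fun z => h * z)); last by lin.
by apply: eq_tlift => a1 a2; rewrite -scalerAr mulrA.
Qed.

(** The value of (h (x) x) . a, where r is the second part of the coproduct of
    x. *)
Definition tangent_ract_pure (r : tensor (fdual H) (qt_type g)) (h a : H) : T :=
  \tsum_(a1, a2 <- comul a) \tsum_(f, y <- r) (((fdual_val f a2 : k) *: (h * a1)) \ox y).

Lemma tangent_vec_ract_pure (x : qt_type g) (r : tensor (fdual H) (qt_type g))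
    (h a b : H) :
  (forall a b : H, qt_fun x (a * b) =
    qt_fun x a * counit b + \tsum_(f, y <- r) (fdual_val f a * qt_fun y b : k^o)) ->
  tangent_vec (tangent_ract_pure r h a) b =
    tangent_vec (h \ox x) (a * b) - tangent_vec (h \ox x) a * b.
Proof.
move=> rE; have lv := @tangent_vecl _ _ g.
apply/eqP; rewrite eq_sym subr_eq eq_sym; apply/eqP.
rewrite !tangent_vec_pure sw_mul; last by lin.
rewrite (tlift_comp _ (F := fun z => z * b)); last by lin.
rewrite /tangent_ract_pure (tlift_comp _ (F := fun Y => tangent_vec Y b)); last by lin.
rewrite -tlift_add_body; apply: eq_tlift => a1 a2.
transitivity (\tsum_(b1, b2 <- comul b)
  (\tsum_(f, y <- r) ((fdual_val f a2 * qt_fun y b2 : k) *: (h * (a1 * b1))) +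
   counit b2 *: ((qt_fun x a2 : k) *: (h * (a1 * b1))))).
  rewrite tlift_add_body; congr (_ + _); last first.
    rewrite (sw_counitr (F := fun b1 => (qt_fun x a2 : k) *: (h * (a1 * b1)))); last by lin.
    by rewrite -scalerAl mulrA.
  rewrite (tlift_comp _ (F := fun Y => tangent_vec Y b)); last by lin.
  rewrite tlift_swap; apply: eq_tlift => f y; rewrite tangent_vec_pure.
  by apply: eq_tlift => b1 b2; rewrite -scalerAl scalerA mulrC mulrA.
apply: eq_tlift => b1 b2; rewrite rE scalerDl addrC scalerA [counit b2 * _]mulrC.
congr (_ + _).
by rewrite (tlift_comp _ (F := fun c : k^o => (c : k) *: (h * (a1 * b1)))) //; lin.
Qed.

Lemma tangent_ract_exists (X : T) a : exists Y : T, forall b,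
  tangent_vec Y b = tangent_vec X (a * b) - tangent_vec X a * b.
Proof.
elim/tensor_ind: X => [|X X' [Y YE] [Y' YE']|h x].
- exists 0 => b.
  have v0 c : tangent_vec (0 : T) c = 0.
    exact: (linear0E (@tangent_vecl _ _ g c)).
  by rewrite !v0 mul0r subr0.
- exists (Y + Y') => b.
  have vD c Z Z' : tangent_vec (Z + Z' : T) c = tangent_vec Z c + tangent_vec Z' c.
    by have := tangent_vecl c 1 Z Z'; rewrite !scale1r.
  by rewrite !vD YE YE' mulrDl opprD addrACA.
- have [r rE] := qt_mul x; exists (tangent_ract_pure r h a) => b.
  exact: tangent_vec_ract_pure.
Qed.

(** Chosen as the element prescribed by the Leibniz rule: unique since L is
    injective, it depends neither on a basis of g nor on a presentation of the
    coproducts. *)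
Definition tangent_ract (X : T) (a : H) : T := projT1 (cid (tangent_ract_exists X a)).

Lemma tangent_vec_ract X a b : tangent_vec (tangent_ract X a) b =
  tangent_vec X (a * b) - tangent_vec X a * b.
Proof. exact: (projT2 (cid (tangent_ract_exists X a))). Qed.

Lemma tangent_ractE (x : qt_type g) (r : tensor (fdual H) (qt_type g)) h a :
  (forall a b : H, qt_fun x (a * b) =
    qt_fun x a * counit b + \tsum_(f, y <- r) (fdual_val f a * qt_fun y b : k^o)) ->
  tangent_ract (h \ox x) a = tangent_ract_pure r h a.
Proof.
move=> rE; apply: tangent_vec_inj => d; rewrite tangent_vec_ract.
by rewrite (tangent_vec_ract_pure _ _ _ rE).
Qed.

Lemma tangent_ract_bilin : bilin tangent_ract.
Proof.
have lv := @tangent_vecl _ _ g; have lr := @tangent_vecr _ _ g.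
split=> [a|X] c x y; apply: tangent_vec_inj => b; rewrite lv !tangent_vec_ract.
  by rewrite !lv mulrDl scalerBr opprD addrACA -scalerAl.
by rewrite lr mulrDl -scalerAl lr mulrDl scalerBr opprD addrACA -scalerAl.
Qed.

Lemma tangent_ract1 X : tangent_ract X 1 = X.
Proof.
apply: tangent_vec_inj => b; rewrite tangent_vec_ract mul1r.
suff -> : tangent_vec X 1 = 0 by rewrite mul0r subr0.
have lv := @tangent_vecl _ _ g.
apply: (tensor_linear_eq (F := fun X => tangent_vec X 1) (G := fun X => 0)); [lin..|].
move=> h x; rewrite tangent_vec_pure sw_1; last by lin.
by rewrite qt_fun1 scale0r.
Qed.

Lemma tangent_ractM X a b : tangent_ract X (a * b) = tangent_ract (tangent_ract X a) b.
Proof.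
apply: tangent_vec_inj => c; rewrite !tangent_vec_ract !mulrA mulrBl.
by rewrite opprB addrA subrK.
Qed.

Lemma tangent_lract h X a :
  tangent_ract (tangent_lact h X) a = tangent_lact h (tangent_ract X a).
Proof.
apply: tangent_vec_inj => c; rewrite tangent_vec_lact !tangent_vec_ract.
by rewrite !tangent_vec_lact mulrBr mulrA.
Qed.

Lemma tangent_lact1 X : tangent_lact 1 X = X.
Proof. by apply: tangent_vec_inj => c; rewrite tangent_vec_lact mul1r. Qed.

Lemma tangent_lactM h h' X : tangent_lact (h * h') X = tangent_lact h (tangent_lact h' X).
Proof. by apply: tangent_vec_inj => c; rewrite !tangent_vec_lact mulrA. Qed.

Definition tangent_bimodule : bimodule H T := Bimodule
  tangent_lact_bilin tangent_ract_bilin tangent_lact1 tangent_lactM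
  tangent_ract1 tangent_ractM tangent_lract.

Definition tangent_vec_map (X : T) : {linear H -> H} := HB.pack (tangent_vec X)
  (GRing.isLinear.Build _ _ _ _ _ (tangent_vecr X)).

Lemma tangent_leibniz X a b : tangent_vec_map X (a * b) =
  tangent_vec_map X a * b + tangent_vec_map (tangent_ract X a) b.
Proof. by rewrite /= tangent_vec_ract addrC subrK. Qed.

Definition tangent_fovc : fovc H T := @Fovc _ _ _ tangent_bimodule tangent_vec_map
  (@tangent_vecl _ _ g) (@tangent_vec_inj _ _ g) tangent_vec_lact tangent_leibniz.

Definition tangent_coact_fun (X : T) : tensor H T :=
  \tsum_(h, x <- X) \tsum_(h1, h2 <- comul h) (h1 \ox (h2 \ox x)).

Lemma tangent_coact_linear : linear tangent_coact_fun.
Proof. by rewrite /tangent_coact_fun; lin. Qed.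

Definition tangent_coaction : {linear T -> tensor H T} := HB.pack tangent_coact_fun
  (GRing.isLinear.Build _ _ _ _ _ tangent_coact_linear).

Lemma tangent_coaction_pure h x :
  tangent_coaction (h \ox x) = \tsum_(h1, h2 <- comul h) (h1 \ox (h2 \ox x)).
Proof. by rewrite /= /tangent_coact_fun tlift_pure //; lin. Qed.

Lemma tangent_coactA X :
    \tsum_(h, y <- tangent_coaction X) \tsum_(a, b <- comul h) (a \ox (b \ox y)) =
    \tsum_(h, y <- tangent_coaction X) (h \ox tangent_coaction y).
Proof.
apply: (tensor_linear_eq (F := fun X =>
   \tsum_(h, y <- tangent_coaction X) \tsum_(a, b <- comul h) (a \ox (b \ox y)))
   (G := fun X => \tsum_(h, y <- tangent_coaction X) (h \ox tangent_coaction y)));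
   [lin..|move=> h x].
rewrite tangent_coaction_pure tlift_tlift; last by lin.
rewrite tlift_tlift; last by lin.
transitivity (\tsum_(h1, h2 <- comul h) \tsum_(a, b <- comul h1) (a \ox (b \ox (h2 \ox x)))).
  by apply: eq_tlift => h1 h2; rewrite tlift_pure //; lin.
rewrite sw_assoc; [|lin..]; apply: eq_tlift => h1 h2; rewrite tlift_pure; last by lin.
rewrite tangent_coaction_pure (tlift_comp _ (F := fun z => h1 \ox z)) //; lin.
Qed.

Lemma tangent_coact_counit X : \tsum_(h, y <- tangent_coaction X) (counit h *: y) = X.
Proof.
apply: (tensor_linear_eq (F := fun X => \tsum_(h, y <- tangent_coaction X) (counit h *: y))
   (G := fun X => X)); [lin..|move=> h x].
rewrite tangent_coaction_pure tlift_tlift; last by lin.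
rewrite -[RHS](sw_counitl (F := fun h => h \ox x)); last by lin.
by apply: eq_tlift => h1 h2; rewrite tlift_pure //; lin.
Qed.

Lemma tangent_coact_bimodule h X a :
    tangent_coaction (tangent_ract (tangent_lact h X) a) =
    \tsum_(h1, h2 <- comul h) \tsum_(y, z <- tangent_coaction X) \tsum_(a1, a2 <- comul a)
      ((h1 * y * a1) \ox tangent_ract (tangent_lact h2 z) a2).
Proof.
have bl := tangent_lact_bilin; have br := tangent_ract_bilin.
apply: (tensor_linear_eq (F := fun X => tangent_coaction (tangent_ract (tangent_lact h X) a))
   (G := fun X => \tsum_(h1, h2 <- comul h) \tsum_(y, z <- tangent_coaction X)
     \tsum_(a1, a2 <- comul a)
      ((h1 * y * a1) \ox tangent_ract (tangent_lact h2 z) a2))); [lin..|move=> h' x].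
have [r rE] := qt_mul x.
have ractE c b := tangent_ractE c b rE.
rewrite tangent_lact_pure ractE tangent_coaction_pure /tangent_ract_pure.
rewrite (tlift_comp _ (F := tangent_coaction)); last by lin.
transitivity (\tsum_(a1, a2 <- comul a) \tsum_(h1, h2 <- comul h)
  \tsum_(h'1, h'2 <- comul h') \tsum_(b1, b2 <- comul a1) \tsum_(f, y <- r)
   ((h1 * h'1 * b1) \ox (((fdual_val f a2 : k) *: (h2 * h'2 * b2)) \ox y))).
  apply: eq_tlift => a1 a2.
  rewrite (tlift_comp _ (F := tangent_coaction)); last by lin.
  transitivity (\tsum_(z1, z2 <- comul (h * h' * a1)) \tsum_(f, y <- r)
     (z1 \ox (((fdual_val f a2 : k) *: z2) \ox y))).
    rewrite tlift_swap; apply: eq_tlift => f y.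
    rewrite (linearZE (F := fun z => tangent_coaction (z \ox y))); last by lin.
    rewrite tangent_coaction_pure -tlift_scale_body; apply: eq_tlift => z1 z2.
    by rewrite (linearZE (F := fun z => z1 \ox (z \ox y))) //; lin.
  rewrite sw_mul; last by lin.
  rewrite sw_mul; last by lin.
  by [].
rewrite tlift_swap; apply: eq_tlift => h1 h2.
rewrite tlift_swap tlift_tlift; last by lin.
apply: eq_tlift => h'1 h'2; rewrite tlift_pure; last by lin.
rewrite sw_assoc; [|lin..]; apply: eq_tlift => a1 a2.
rewrite tangent_lact_pure ractE /tangent_ract_pure.
rewrite (tlift_comp _ (F := fun z => (h1 * h'1 * a1) \ox z)); last by lin.
apply: eq_tlift => b1 b2.
by rewrite (tlift_comp _ (F := fun z => (h1 * h'1 * a1) \ox z)) //; lin.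
Qed.

Lemma tangent_coact_vecL X a : comul (tangent_vec_map X a) =
    \tsum_(y, z <- tangent_coaction X) \tsum_(a1, a2 <- comul a)
      ((y * a1) \ox tangent_vec_map z a2).
Proof.
have lv := @tangent_vecl _ _ g; have lr := @tangent_vecr _ _ g.
rewrite /tangent_vec_map /=.
apply: (tensor_linear_eq (F := fun X => comul (tangent_vec X a))
   (G := fun X => \tsum_(y, z <- tangent_coaction X) \tsum_(a1, a2 <- comul a)
      ((y * a1) \ox tangent_vec z a2))); [lin..|move=> h x].
rewrite tangent_coaction_pure tangent_vec_pure tlift_tlift; last by lin.
transitivity (\tsum_(a1, a2 <- comul a) \tsum_(h1, h2 <- comul h)
  \tsum_(b1, b2 <- comul a1) ((h1 * b1) \ox ((qt_fun x a2 : k) *: (h2 * b2)))).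
  rewrite (tlift_comp _ (F := comul)); last by lin.
  apply: eq_tlift => a1 a2; rewrite (linearZE (F := comul)); last by lin.
  rewrite -[comul _]tlift_tpure sw_mul; last by lin.
  rewrite -tlift_scale_body; apply: eq_tlift => h1 h2; rewrite -tlift_scale_body.
  by apply: eq_tlift => b1 b2; rewrite (linearZE (F := fun z => _ \ox z)) //; lin.
rewrite tlift_swap; apply: eq_tlift => h1 h2.
rewrite tlift_pure; last by lin.
rewrite sw_assoc; [|lin..]; apply: eq_tlift => a1 a2; rewrite tangent_vec_pure.
by rewrite (tlift_comp _ (F := fun z => (h1 * a1) \ox z)) //; lin.
Qed.

Definition tangent_calculus : cov_fovc H T := @CovFovc _ _ _ tangent_fovc
  tangent_coaction tangent_coactA tangent_coact_counit tangent_coact_bimodule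
  tangent_coact_vecL.

End TangentCalculus.

(** * From quantum tangent spaces to calculi *)

Section FiniteFamily.
Variables (k : fieldType) (V : lmodType k).

Lemma findim_family (S : V -> Prop) m (c : 'I_m -> V) :
  (forall i, S (c i)) ->
  (forall v, S v -> exists a : 'I_m -> k, v = \sum_(i < m) a i *: c i) ->
  findim S.
Proof.
move=> Sc cS; exists [seq c i | i <- enum 'I_m]; split.
  by move=> _ /mapP[i _ ->].
move=> v /cS[a ->]; exists (fun i => oapp a 0 (insub i)).
rewrite size_map size_enum_ord; apply: eq_bigr => i _; rewrite valK /=.
by rewrite (nth_map i) ?size_enum_ord // nth_ord_enum.
Qed.

Lemma findim_familyP (S : V -> Prop) : findim S ->
  exists m (c : 'I_m -> V), (forall i, S (c i)) /\
    forall v, S v -> exists a : 'I_m -> k, v = \sum_(i < m) a i *: c i.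
Proof.
case=> s [sS Ss]; exists (size s), (fun i => s`_i); split.
  by move=> i; apply: sS; exact: mem_nth.
by move=> v /Ss[a ->]; exists (fun i => a i).
Qed.

End FiniteFamily.

Section TangentCorrespondence.
Variables (k : fieldType) (H : hopfAlgType k).

(** The map Q sends h (x) (h' (x) x) to eps(h') h (x) x: it recovers X from its
    coaction, and sends 1 (x) X into 1 (x) g. *)
Lemma coinv_tangent (g : qtspace H) (X : tensor H (qt_type g)) :
  coinv (tangent_calculus g) X -> exists x, X = 1 \ox x.
Proof.
rewrite /coinv /= => cX; exists (\tsum_(h, x <- X) (counit h *: x)).
pose Q (t : tensor H (tensor H (qt_type g))) : tensor H (qt_type g) :=
  \tsum_(h, Y <- t) \tsum_(h', x <- Y) ((counit h' *: h) \ox x).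
have lQ : linear Q by rewrite /Q; lin.
transitivity (Q (tangent_coaction g X)); last first.
  rewrite [tangent_coaction g X]cX /Q tlift_pure; last by lin.
  rewrite (tlift_comp _ (F := fun x => 1 \ox x)); last by lin.
  apply: eq_tlift => h x; rewrite (linearZE (F := fun y => y \ox x)); last by lin.
  by rewrite (linearZE (F := fun y => 1 \ox y)) //; lin.
apply: (tensor_linear_eq (F := fun X => X) (G := fun X => Q (tangent_coaction g X)));
  [lin..|move=> h x].
rewrite tangent_coaction_pure (tlift_comp _ (F := Q)) //.
rewrite -[LHS](sw_counitr (F := fun h => h \ox x)); last by lin.
apply: eq_tlift => h1 h2; rewrite /Q tlift_pure; last by lin.
rewrite tlift_pure; last by lin.
by rewrite (linearZE (F := fun h => h \ox x)) //; lin.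
Qed.

Lemma coinv_tangent_pure (g : qtspace H) (x : qt_type g) :
  coinv (tangent_calculus g) (1 \ox x).
Proof.
rewrite /coinv -[LHS]/(tangent_coaction g _) tangent_coaction_pure.
by rewrite sw_1 //; lin.
Qed.

Lemma tangent_findim (g : qtspace H) : findim (coinv (tangent_calculus g)).
Proof.
have [m [s [c frame]]] := qt_dual_frame g.
apply: (findim_family (c := fun i => 1 \ox c i)) => [i|X /coinv_tangent[x ->]].
  exact: coinv_tangent_pure.
exists (fun i => qt_fun x (s i)).
rewrite {1}(frame x) (linear_sumE (F := fun y => 1 \ox y)); last by lin.
by apply: eq_bigr => i _; rewrite (linearZE (F := fun y => 1 \ox y)) //; lin.
Qed.

Lemma tangent_calculusP (g : qtspace H) : is_tangent_calculus (tangent_calculus g).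
Proof.
split=> [n chi f chi_basis fE h' h i a|h x|h x a].
- pose r : tensor (fdual H) (qt_type g) := \sum_(j < n) f i j \ox chi j.
  rewrite -[LHS]/(tangent_ract (tangent_lact h' (h \ox chi i)) a).
  rewrite tangent_lact_pure (@tangent_ractE _ _ _ _ r).
    rewrite /tangent_ract_pure.
    transitivity (\tsum_(a1, a2 <- comul a) \sum_(j < n)
        (((f i j a2 : k) *: (h' * h * a1)) \ox chi j)).
      apply: eq_tlift => a1 a2; rewrite /r linear_sumE; last by apply: tlift_linear; lin.
      by apply: eq_bigr => j _; rewrite tlift_pure //; lin.
    rewrite /tlift /tsum exchange_big; apply: eq_bigr => j _ /=.
    by rewrite (linear_sumE (F := fun z => z \ox chi j)) //; lin.
  move=> b c; rewrite {1}/qt_fun -fdual_comulE fE /fdual_eval2.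
  have lE := tlift_linear (eval2_bilin b c).
  rewrite -[X in X + _]scale1r lE scale1r tlift_pure; last exact: eval2_bilin.
  congr (_ + _); rewrite /r !linear_sumE //; last by apply: tlift_linear; lin.
  apply: eq_bigr => j _; rewrite (tlift_pure _ _ (eval2_bilin b c)).
  by rewrite [RHS]tlift_pure; [|lin].
- exact: tangent_coaction_pure.
- exact: tangent_vec_pure.
Qed.

Definition tangent_fin_calculus (g : qtspace H) : fin_calculus H :=
  FinCalculus (@tangent_findim g).

Lemma counit_tangent_vec (g : qtspace H) (x : qt_type g) a :
  counit (tangent_vec (1 \ox x) a) = qt_fun x a.
Proof.
have lc : linear (fun z : H => counit z : k^o) by lin.
rewrite tangent_vec_pure [LHS](tlift_comp _ _ lc).
rewrite -[RHS](sw_counitl (F := qt_fun x)); last by lin.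
by apply: (eq_tlift (X := k^o)) => a1 a2; rewrite mul1r linearZ /= mulrC.
Qed.

(** An isomorphism maps 1 (x) u to a coinvariant 1 (x) y with the same L, and u
    is eps o L_(1 (x) u). *)
Lemma tangent_iso_subset (g g' : qtspace H) :
  calc_iso (tangent_fin_calculus g) (tangent_fin_calculus g') ->
  forall u, u \in g -> u \in g'.
Proof.
case=> phi [_ _ _ phi_coact phi_vec] u ug; pose x : qt_type g := SubspaceType ug.
have [y phix] : exists y, phi (1 \ox x) = 1 \ox y.
  apply: coinv_tangent; rewrite /coinv phi_coact.
  have -> : coact (tangent_fin_calculus g) (1 \ox x) = 1 \ox (1 \ox x).
    exact: coinv_tangent_pure.
  by rewrite tlift_pure //; lin.
suff -> : u = \val y by exact: subspace_valP.
apply: fdual_ext => a; rewrite -/(qt_fun y a) -[LHS]/(qt_fun x a).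
rewrite -(counit_tangent_vec x) -(counit_tangent_vec y) -phix.
exact: (congr1 (fun z => counit z) (esym (phi_vec (1 \ox x) a))).
Qed.

Lemma qtspace_eq (g g' : qtspace H) : (forall u, (u \in g) = (u \in g')) -> g = g'.
Proof.
case: g => [[S Sp] Sf S1 Sc]; case: g' => [[S' Sp'] Sf' S1' Sc'] /= SS'.
have e : S = S' by apply/funext => u; exact: SS'.
subst S'.
have e : Sp = Sp' by exact: Prop_irrelevance.
subst Sp'.
congr QTSpace; exact: Prop_irrelevance.
Qed.

Lemma tangent_class_inj :
  injective (fun g : qtspace H => class_of (tangent_fin_calculus g)).
Proof.
move=> g g' /class_ofP iso; apply: qtspace_eq => u.
apply/idP/idP; first exact: tangent_iso_subset.
by apply: tangent_iso_subset; exact: calc_iso_sym.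
Qed.

End TangentCorrespondence.

(** * Functionals with finitely many translates *)

Section FiniteDualCriteria.
Variables (k : fieldType) (H : hopfAlgType k).

(** The e_i vanish on the ideal that consists of the a with e_i(a b) = 0 for all b; it
    is a left ideal because the translates of the e_i are combinations of the
    e_j, and cofinite because finitely many b suffice to detect it. *)
Lemma fdual_of_translates n (e : 'I_n -> H -> k^o) : (forall i, linear (e i)) ->
  (forall i a, exists d : 'I_n -> k, forall b, e i (a * b) = \sum_(j < n) d j * e j b) ->
  forall i, e i \in @fdual_pred k H.
Proof.
move=> le eM i0; have le0 i : e i 0 = 0 := linear0E (le i).
apply/asboolP; split; first exact: le.
exists (fun a => forall i b, e i (a * b) = 0); split; last first.
- by move=> a /(_ i0 1); rewrite mulr1.
- have lp : linear (fun h => \row_(i < n) e i h : 'rV[k]_n).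
    by move=> a x y; apply/rowP => i; rewrite !mxE le.
  pose p : {linear H -> 'rV[k]_n} := HB.pack (fun h => \row_(i < n) e i h : 'rV[k]_n)
    (GRing.isLinear.Build _ _ _ _ _ lp).
  have [m [s [q pq]]] := finite_test p.
  have eE j b : e j b = \sum_(l < m) (p b *m q) 0 l * e j (s l).
    transitivity (p b 0 j); first by rewrite mxE.
    by rewrite {1}(pq b) summxE; apply: eq_bigr => l _; rewrite !mxE.
  pose M a : 'M[k]_(n, m) := \matrix_(i, l) e i (a * s l).
  have lM : linear (fun a => mxvec (M a)).
    move=> c a b; rewrite -linearP; congr mxvec; apply/matrixP => i l.
    by rewrite !mxE mulrDl -scalerAl le.
  pose pM : {linear H -> 'rV[k]_(n * m)} := HB.pack (fun a => mxvec (M a))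
    (GRing.isLinear.Build _ _ _ _ _ lM).
  exists (n * m)%N, pM => a; split=> [a0|pa0 i b].
    rewrite -[pM a]/(mxvec (M a)) (_ : M a = 0) ?linear0 //.
    by apply/matrixP => i l; rewrite !mxE a0.
  have Ma0 : M a = 0 by apply/eqP; rewrite -mxvec_eq0; apply/eqP.
  have [d dE] := eM i a; rewrite dE.
  under eq_bigr do rewrite eE mulr_sumr.
  rewrite exchange_big big1 // => l _.
  transitivity ((p b *m q) 0 l * \sum_(j < n) d j * e j (s l)).
    by rewrite mulr_sumr; apply: eq_bigr => j _; rewrite mulrCA.
  have := congr1 (fun A : 'M_(n, m) => A i l) Ma0.
  by rewrite !mxE dE => ->; rewrite mulr0.
- split; first split.
  + by apply/asboolP => i b; rewrite mul0r le0.
  + move=> c x y /asboolP x0 /asboolP y0; apply/asboolP => i b.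
    by rewrite mulrDl -scalerAl le x0 y0 scaler0 addr0.
  + move=> a h h0; split=> i b; last by rewrite -mulrA h0.
    have [d dE] := eM i a; rewrite -mulrA dE big1 // => j _.
    by rewrite h0 mulr0.
Qed.

Lemma fdual_rtranslate (u : fdual H) s : (fun a => u (a * s)) \in @fdual_pred k H.
Proof.
have /asboolP[lu [I [iI cI uI]]] := fdual_valP u; apply/asboolP; split; first by lin.
exists I; split=> // a Ia; apply: uI.
by have [_ /(_ s a Ia)[]] := iI.
Qed.

(** In a dual frame of S, the coefficients of the translated part
    u(a _) - u(a) eps are right translates of u, up to multiples of u; so they
    lie in the finite dual. *)
Lemma translation_comul (S : subspace (fdual H)) :
  findim (fun u => u \in S) ->
  (forall u a, u \in S ->
    exists2 w, w \in S & forall b,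
      fdual_val u (a * b) = fdual_val u a * counit b + fdual_val w b) ->
  forall u, u \in S ->
  exists (v : subspace_type S) (r : tensor (fdual H) (subspace_type S)),
      fdual_comul u = \val v \ox fdual_counit H + \tsum_(f, x <- r) (f \ox \val x).
Proof.
move=> finS S_transl u uS; have [m [s [c [cS frame]]]] := fdual_dual_frame finS.
pose f l : fdual H := FDual (fdual_rtranslate u (s l)) - (counit (s l) : k) *: u.
exists (SubspaceType uS), (\sum_(l < m) f l \ox SubspaceType (cS l)).
have lval : linear (fun x : subspace_type S => \val x) by [].
have bval : bilin (fun f (x : subspace_type S) => f \ox \val x :> tensor (fdual H) (fdual H)).
  by lin.
rewrite (linear_sumE (F := tlift _)); last exact: tlift_linear bval.
apply: fdual_eval2_inj => a b; rewrite fdual_comulE /fdual_eval2.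
have lE := tlift_linear (eval2_bilin a b).
rewrite -[X in tlift _ (X + _)]scale1r lE scale1r tlift_pure; last exact: eval2_bilin.
have [w wS wE] := S_transl u a uS; rewrite [LHS]wE; congr (_ + _).
rewrite linear_sumE // {1}(frame w wS) fdual_sum; apply: eq_bigr => l _.
rewrite tlift_pure; last by lin.
rewrite tlift_pure; last exact: eval2_bilin.
rewrite fdualZ; congr (_ * _).
rewrite /f fdualD -scaleN1r !fdualZ /= wE mulN1r.
by rewrite addrC mulrC addrA addNr add0r.
Qed.

End FiniteDualCriteria.

(** * The Hopf module underlying a covariant calculus *)

Section CovariantCalculus.
Variables (k : fieldType) (H : hopfAlgType k) (X : lmodType k) (C : cov_fovc H X).
Implicit Types (x v : X) (h a b : H).

Lemma sw_coactA (V : lmodType k) (F : H -> H -> X -> V) x :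
  (forall b c, linear (fun a => F a b c)) ->
  (forall a c, linear (fun b => F a b c)) ->
  (forall a b, linear (fun c => F a b c)) ->
  \tsum_(h, y <- coact C x) \tsum_(a, b <- comul h) F a b y =
  \tsum_(h, y <- coact C x) \tsum_(h', z <- coact C y) F h h' z.
Proof.
move=> l1 l2 l3.
have bF : bilin (fun a t => tlift (F a) t) by lin.
have := congr1 (tlift (fun a t => tlift (F a) t)) (coactA C x).
rewrite !tlift_tlift // => e.
etransitivity; last first.
  apply: eq_tlift => h y.
  by rewrite -(tlift_pure h (coact C y) bF).
rewrite -e; apply: eq_tlift => h y; rewrite tlift_tlift //.
by apply: eq_tlift => a b; rewrite !tlift_pure //; lin.
Qed.

Lemma sw_coact_counit (V : lmodType k) (F : X -> V) x : linear F ->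
  \tsum_(h, y <- coact C x) (counit h *: F y) = F x.
Proof.
move=> lF; rewrite -[in RHS](coact_counit C x) (tlift_comp _ _ lF).
by apply: eq_tlift => a b; rewrite linearZE.
Qed.

Lemma coact_lact h x : coact C (lact C h x) =
  \tsum_(a, b <- comul h) \tsum_(y, z <- coact C x) ((a * y) \ox lact C b z).
Proof.
have bl := lact_bilin C; have br := ract_bilin C.
rewrite -[lact C h x](ract1 C) coact_bimodule; apply: eq_tlift => a b.
by apply: eq_tlift => y z; rewrite sw_1 ?mulr1 ?ract1 //; lin.
Qed.

Definition coinv_proj x : X := \tsum_(h, y <- coact C x) lact C (antipode h) y.

Lemma coinv_proj_linear : linear coinv_proj.
Proof. by have bl := lact_bilin C; rewrite /coinv_proj; lin. Qed.

(** By anticomultiplicativity of the antipode the coaction of S(x_(-1)) . x_0 is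
    S(x_(-2)) x_(-1) (x) S(x_(-3)) . x_0, where the first factor collapses. *)
Lemma coinv_projP x : coinv C (coinv_proj x).
Proof.
have bl := lact_bilin C; rewrite /coinv /coinv_proj (tlift_comp _ (F := coact C)); last by lin.
rewrite (tlift_comp _ (F := fun z => 1 \ox z)); last by lin.
transitivity (\tsum_(h, y <- coact C x) \tsum_(a, b <- comul h)
   \tsum_(y', z <- coact C y) ((antipode b * y') \ox lact C (antipode a) z)).
  apply: eq_tlift => h y; rewrite coact_lact sw_antipode; last by lin.
  by [].
rewrite sw_coactA; [|lin..]; apply: eq_tlift => h y.
rewrite -(sw_coactA (F := fun h' y' z => (antipode h' * y') \ox lact C (antipode h) z));
  [|lin..].
rewrite -(sw_coact_counit (F := fun y => 1 \ox lact C (antipode h) y)); last by lin.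
apply: eq_tlift => w z.
by rewrite (sw_antipodel (F := fun a => a \ox lact C (antipode h) z)) //; lin.
Qed.

(** The antipode axiom collapses x_(-2) S(x_(-1)) . x_0 to x. *)
Lemma coinv_proj_decomp x : x = \tsum_(h, y <- coact C x) lact C h (coinv_proj y).
Proof.
have bl := lact_bilin C.
transitivity (\tsum_(h, y <- coact C x) \tsum_(a, b <- comul h) lact C (a * antipode b) y).
  rewrite -[LHS](sw_coact_counit (F := fun x => x)) //; apply: eq_tlift => h y.
  by rewrite (sw_antipoder (F := fun a => lact C a y)) ?lact1 //; lin.
rewrite sw_coactA; [|lin..]; apply: eq_tlift => h y.
rewrite /coinv_proj (tlift_comp _ (F := lact C h)); last by lin.
by apply: eq_tlift => h' z; rewrite lactM.
Qed.

Definition vec_fun x a : k^o := counit (vecL C x a).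

Lemma vec_funl a : linear (fun x => vec_fun x a).
Proof. by have lv := vecL_linear C; rewrite /vec_fun; lin. Qed.

Lemma vec_funr x : linear (vec_fun x).
Proof. by rewrite /vec_fun; lin. Qed.

(** Apply id (x) eps to the colinearity equation; for coinvariant v it reads
    Delta(L_v(a)) = a_1 (x) L_v(a_2). *)
Lemma vecL_coinv v a : coinv C v ->
  vecL C v a = \tsum_(a1, a2 <- comul a) ((vec_fun v a2 : k) *: a1).
Proof.
move=> vC; have lv := vecL_linear C; have lf := vec_funl.
transitivity (\tsum_(b1, b2 <- comul (vecL C v a)) (counit b2 *: b1)).
  by rewrite comul_counitr.
rewrite (coact_vecL C) vC tlift_pure; last by lin.
rewrite tlift_tlift; last by lin.
by apply: eq_tlift => a1 a2; rewrite tlift_pure ?mul1r //; lin.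
Qed.

Lemma vec_fun_coinv_inj v w : coinv C v -> coinv C w -> vec_fun v =1 vec_fun w -> v = w.
Proof.
move=> vC wC vw; apply: (vecL_inj (f := C)) => a; rewrite !vecL_coinv //.
by apply: eq_tlift => a1 a2; rewrite vw.
Qed.

Lemma vec_fun1 x : vec_fun x 1 = 0.
Proof.
have := vecL_leibniz C x 1 1; rewrite !mulr1 ract1 => /(congr1 (fun z => z - vecL C x 1)).
rewrite subrr addrK => /esym e.
by rewrite /vec_fun e linear0.
Qed.

(** The functional eps o L is left H-linear for the trivial action on k, so it
    only sees the coinvariant part of x. *)
Lemma vec_fun_proj x a : vec_fun (coinv_proj x) a = vec_fun x a.
Proof.
have lf := vec_funl a; have lP := coinv_proj_linear.
rewrite [in RHS](coinv_proj_decomp x) (tlift_comp _ (F := vec_fun^~ a)) //.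
rewrite -[LHS](sw_coact_counit (F := fun x => vec_fun (coinv_proj x) a)); last by lin.
apply: (eq_tlift (X := k^o)) => h y.
by rewrite /vec_fun vecL_lact counitM.
Qed.

(** For coinvariant x all three functionals come from coinvariants: this is the
    product rule that a quantum tangent space needs. *)
Lemma vec_fun_translate x a b : vec_fun x (a * b) =
  vec_fun x a * counit b + vec_fun (coinv_proj (ract C x a)) b.
Proof. by rewrite vec_fun_proj /vec_fun vecL_leibniz linearD counitM. Qed.

Lemma coinv_submod : submod_closed [pred x | `[< coinv C x >]].
Proof.
split.
  apply/asboolP; rewrite /coinv linear0.
  by rewrite (linear0E (F := fun x : X => 1 \ox x)) //; lin.
move=> a x y /asboolP xC /asboolP yC; apply/asboolP; rewrite /coinv linearP xC yC.
by have [_ /(_ 1)->] := @tpure_bilin k H X.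
Qed.

End CovariantCalculus.

(** * The quantum tangent space of a calculus *)

Section TangentSpace.
Variables (k : fieldType) (H : hopfAlgType k) (C : fin_calculus H).
Implicit Types (x v : calc_space C).

Lemma vec_fun_fdual v : coinv C v -> vec_fun C v \in @fdual_pred k H.
Proof.
move=> vC; have [m [c [cC frame]]] := findim_familyP (calc_findim C).
have lf := vec_funl C; have lr := @vec_funr _ _ _ C.
(* The functionals chi_v alone are not stable under translations: eps is needed. *)
pose e (i : 'I_m.+1) : H -> k^o :=
  if unlift ord0 i is Some j then vec_fun C (c j) else (fun a => counit a).
have e0 : e ord0 = (fun a => counit a) by rewrite /e unlift_none.
have eS j : e (lift ord0 j) = vec_fun C (c j) by rewrite /e liftK.
have vE w : coinv C w -> exists d : 'I_m -> k,
    forall b, vec_fun C w b = \sum_(j < m) d j * vec_fun C (c j) b.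
  move=> /frame[d ->]; exists d => a.
  rewrite (linear_sumE (F := fun w => vec_fun C w a)) //.
  by apply: eq_bigr => j _; rewrite (linearZE (F := fun w => vec_fun C w a)).
have eP : forall i, e i \in @fdual_pred k H.
  apply: fdual_of_translates => [i|i a].
    by rewrite /e; case: unliftP => [j|] _ //; lin.
  case: (unliftP ord0 i) => [j|] ->.
    have [d dE] := vE _ (coinv_projP C (ract C (c j) a)).
    exists (fun i => if unlift ord0 i is Some l then d l else vec_fun C (c j) a) => b.
    rewrite eS big_ord_recl unlift_none e0 vec_fun_translate dE; congr (_ + _).
    by apply: eq_bigr => l _; rewrite liftK eS.
  exists (fun i => if unlift ord0 i is Some l then 0 else counit a) => b.
  rewrite e0 big_ord_recl unlift_none e0 counitM big1 ?addr0 // => l _.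
  by rewrite liftK mul0r.
have [d dE] := vE v vC.
have -> : vec_fun C v = \sum_(j < m) d j *: (vec_fun C (c j) : H -> k^o).
  by apply/funext => a; rewrite dE fct_sumE.
by apply: rpred_sum => j _; apply: rpredZ; rewrite -eS.
Qed.

Definition tangent_pred : {pred fdual H} :=
  fun u => `[< exists2 v, coinv C v & fdual_val u = vec_fun C v >].

Lemma tangent_submod : submod_closed tangent_pred.
Proof.
have lf := vec_funl C; have [c0 cD] := coinv_submod C.
split.
  apply/asboolP; exists 0; first by apply/asboolP.
  by apply/funext => a; rewrite (linear0E (lf a)).
move=> a u w /asboolP[v vC uE] /asboolP[v' vC' wE]; apply/asboolP.
exists (a *: v + v').
  by apply/asboolP/cD; apply/asboolP.
by apply/funext => b; rewrite lf fdualD fdualZ uE wE.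
Qed.

Definition tangent_subspace : subspace (fdual H) := Subspace tangent_submod.

Lemma tangent_subspaceP u :
  reflect (exists2 v, coinv C v & fdual_val u = vec_fun C v) (u \in tangent_subspace).
Proof. exact: asboolP. Qed.

Lemma tangent_subspace_findim : findim (fun u => u \in tangent_subspace).
Proof.
have lf := vec_funl C.
have [m [c [cC frame]]] := findim_familyP (calc_findim C).
apply: (findim_family (c := fun i => FDual (vec_fun_fdual (cC i)))) => [i|u].
  by apply/tangent_subspaceP; exists (c i).
move=> /tangent_subspaceP[v /frame[d ->] uE]; exists d.
apply: fdual_ext => a; rewrite uE fdual_sum.
rewrite (linear_sumE (F := fun w => vec_fun C w a)) //.
by apply: eq_bigr => j _; rewrite (linearZE (F := fun w => vec_fun C w a)).
Qed.

Lemma tangent_subspace_plus u : u \in tangent_subspace -> u 1 = 0.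
Proof. by move=> /tangent_subspaceP[v _ ->]; exact: vec_fun1. Qed.

Lemma tangent_subspace_translate u a : u \in tangent_subspace ->
  exists2 w, w \in tangent_subspace &
    forall b, fdual_val u (a * b) = fdual_val u a * counit b + fdual_val w b.
Proof.
move=> /tangent_subspaceP[v vC uE].
have wC := coinv_projP C (ract C v a).
exists (FDual (vec_fun_fdual wC)) => [|b]; last by rewrite uE vec_fun_translate.
by apply/tangent_subspaceP; eexists; first exact: wC.
Qed.

Definition tangent_space : qtspace H := QTSpace tangent_subspace_findim
  tangent_subspace_plus (translation_comul tangent_subspace_findim tangent_subspace_translate).

Lemma tangent_field_exists (u : qt_type tangent_space) :
  exists v, coinv C v /\ forall a, qt_fun u a = vec_fun C v a.
Proof.
by have /tangent_subspaceP[v vC uE] := subspace_valP u; exists v; rewrite /qt_fun uE.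
Qed.

(** The map psi : h (x) chi_v |-> h . v commutes with L, so it is injective, and
    its compatibility with both actions is checked after L; it is surjective by
    the decomposition of x through the projection onto the coinvariants. *)
Lemma tangent_space_iso : calc_iso (tangent_fin_calculus tangent_space) C.
Proof.
have lf := vec_funl C; have bl := lact_bilin C; have lL := vecL_linear C.
have lv := @tangent_vecl _ _ tangent_space.
have [fld fldP] := choice tangent_field_exists.
have fldC u : coinv C (fld u) by have [] := fldP u.
have fldE u a : qt_fun u a = vec_fun C (fld u) a by have [_] := fldP u.
have lfld : linear fld.
  move=> a u w; have [_ cD] := coinv_submod C.
  apply: (vec_fun_coinv_inj (C := C)) => //.
    by apply/asboolP/cD; apply/asboolP.
  move=> b; rewrite lf -!fldE.
  have lq : linear (fun u : qt_type tangent_space => qt_fun u b) by lin.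
  exact: lq.
pose psi_fun (t : tensor H (qt_type tangent_space)) : calc_space C :=
  \tsum_(h, u <- t) lact C h (fld u).
have lpsi : linear psi_fun by rewrite /psi_fun; lin.
pose psi : {linear tensor H (qt_type tangent_space) -> calc_space C} :=
  HB.pack psi_fun (GRing.isLinear.Build _ _ _ _ _ lpsi).
have psi_pure h u : psi (h \ox u) = lact C h (fld u).
  by rewrite /= /psi_fun tlift_pure //; lin.
have psi_vec t a : vecL C (psi t) a = tangent_vec t a.
  apply: (tensor_linear_eq (F := fun t => vecL C (psi t) a)
    (G := fun t => tangent_vec t a)); [lin..|move=> h u].
  rewrite psi_pure vecL_lact vecL_coinv // tangent_vec_pure.
  rewrite (tlift_comp _ (F := fun b => h * b)); last by lin.
  by apply: eq_tlift => a1 a2; rewrite fldE -scalerAr.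
exists psi; split=> [|h t|t a|t|t a].
- have psi_inj : injective psi.
    by move=> s t st; apply: tangent_vec_inj => a; rewrite -!psi_vec st.
  have fld_proj y : exists u, fld u = coinv_proj C y.
    have yC := coinv_projP C y.
    have ug : FDual (vec_fun_fdual yC) \in tangent_space.
      by apply/tangent_subspaceP; exists (coinv_proj C y).
    exists (SubspaceType ug); apply: (vec_fun_coinv_inj (C := C)) => // a.
    by rewrite -fldE.
  have [tan tanE] := choice fld_proj.
  pose psiV x : tensor H (qt_type tangent_space) := \tsum_(h, y <- coact C x) (h \ox tan y).
  have psiVK : cancel psiV psi.
    move=> x; rewrite /psiV (tlift_comp _ (F := psi)); last by lin.
    rewrite [RHS](coinv_proj_decomp C); apply: eq_tlift => h y.
    by rewrite psi_pure tanE.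
  by exists psiV => // t; apply: psi_inj; rewrite psiVK.
- apply: (vecL_inj (f := C)) => a; rewrite vecL_lact !psi_vec.
  exact: tangent_vec_lact.
- apply: (vecL_inj (f := C)) => b; rewrite psi_vec.
  have := vecL_leibniz C (psi t) a b; rewrite !psi_vec => /esym e.
  have rE : tangent_vec (ract (tangent_fin_calculus tangent_space) t a) b =
    tangent_vec t (a * b) - tangent_vec t a * b := tangent_vec_ract t a b.
  by apply: (addrI (tangent_vec t a * b)); rewrite e addrC rE subrK.
- rewrite -[coact (tangent_fin_calculus _) t]/(tangent_coaction _ t).
  apply: (tensor_linear_eq (F := fun t => coact C (psi t))
    (G := fun t => \tsum_(h, y <- tangent_coaction tangent_space t) (h \ox psi y)));
    [lin..|move=> h u].
  rewrite psi_pure coact_lact tangent_coaction_pure tlift_tlift; last by lin.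
  apply: eq_tlift => h1 h2; rewrite fldC tlift_pure; last by lin.
  by rewrite tlift_pure ?mulr1 ?psi_pure //; lin.
- exact: psi_vec.
Qed.

End TangentSpace.

Lemma inj_surj_bij (S T : Type) (f : S -> T) :
  injective f -> (forall y, exists x, f x = y) -> bijective f.
Proof.
move=> f_inj /choice[f' f'K]; exists f' => // x.
by apply: f_inj; rewrite f'K.
Qed.

Theorem theorem3p5 (k : fieldType) (H : hopfAlgType k) :
  exists (C : forall g : qtspace H, cov_fovc H (tensor H (qt_type g)))
         (fin : forall g : qtspace H, findim (coinv (C g))),
    (forall g : qtspace H, is_tangent_calculus (C g)) /\
    bijective (fun g : qtspace H => class_of (FinCalculus (fin g))).
Proof.
exists (@tangent_calculus k H), (@tangent_findim k H).
split; first exact: tangent_calculusP.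
apply: inj_surj_bij; first exact: tangent_class_inj.
case=> P [C PE]; exists (tangent_space C).
transitivity (class_of C); last by apply: eq_exist; rewrite PE.
by apply/class_ofP; exact: tangent_space_iso.
Qed.
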